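(* Let $\Gamma$ be a finite group. The product in the class algebras $R(\Gamma_n)$ $(n\ge1)$ can be written in the form $$\mathfrak p_\rho(n)\circ\mathfrak p_\sigma(n)=\sum_{\nu}d_{\rho\sigma}^{\nu}\,\mathfrak p_\nu(n),\qquad \rho,\sigma\in\mathcal P(\Gamma_* ),$$ where $\nu$ runs over elements of $\mathcal P(\Gamma_* )$ with $\|\nu\|\le\|\rho\|+\|\sigma\|$ and the structure constants $d_{\rho\sigma}^\nu$ are independent of $n$. This gives rise to the stable algebra $\mathfrak A_\Gamma$, with linear basis the symbols $\mathfrak p_\rho$ ($\rho\in\mathcal P(\Gamma_* )$) and multiplication $\mathfrak p_\rho\mathfrak p_\sigma=\sum_\nu d_{\rho\sigma}^\nu\mathfrak p_\nu$, which completely encodes the class algebra structure of $R(\Gamma_n)$ for each $n$ (via $\mathfrak p_\rho\mapsto\mathfrak p_\rho(n)$, a surjective algebra homomorphism $\mathfrak A_\Gamma\to R(\Gamma_n)$).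
   Context: $\Gamma_*$ is the set of conjugacy classes of $\Gamma$. A function $f$ on a finite group $G$ is identified with $\sum_x f(x)x\in\mathbb C[G]$; $R(G)$ (the class algebra) is the space of complex class functions = center of $\mathbb C[G]$, with convolution product $\circ$. $K^c\in R(\Gamma)$ is the characteristic function of $c\in\Gamma_*$ and $1\in R(\Gamma)$ that of the identity element. $\mathcal P(\Gamma_* )$ is the set of families $\rho=(\rho(c))_{c\in\Gamma_*}$ of partitions, $\|\rho\|=\sum_c|\rho(c)|$, and $\rho(c)=(1^{m_1(c)}2^{m_2(c)}\cdots)$. $\Gamma_n=\Gamma^n\rtimes S_n$ with $(g,\sigma)(h,\tau)=(g\,\sigma(h),\sigma\tau)$, $\sigma(h)=(h_{\sigma^{-1}(1)},\ldots,h_{\sigma^{-1}(n)})$, $\Gamma_0$ trivial; $\mathcal R_\Gamma=\bigoplus_{n\ge0}R(\Gamma_n)$; $|0\rangle=1\in R(\Gamma_0)=\mathbb C$. For $r>0$, $\gamma\in R(\Gamma)$, let $\sigma_r(\gamma)\in R(\Gamma_r)$ take value $r\gamma(c)$ on elements $(g,s)$ with $s$ an $r$-cycle $(i_1\cdots i_r)$ and cycle-product $g_{i_r}\cdots g_{i_1}\in c$, and $0$ elsewhere; $\mathfrak p_{-r}(\gamma)$ maps $v\in R(\Gamma_m)$ to $\mathrm{Ind}_{\Gamma_r\times\Gamma_m}^{\Gamma_{r+m}}(\sigma_r(\gamma)\otimes v)$. For $\rho\in\mathcal P(\Gamma_* )$ and $n\ge\|\rho\|$, $$\mathfrak p_\rho(n)=\frac{\mathfrak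 p_{-1}(1)^{n-\|\rho\|}}{(n-\|\rho\|)!}\prod_{c\in\Gamma_*}\prod_{r\ge1}\mathfrak p_{-r}(K^c)^{m_r(c)}|0\rangle\in R(\Gamma_n),$$ and $\mathfrak p_\rho(n)=0$ if $n<\|\rho\|$. The constants $d_{\rho\sigma}^\nu$, being required to be independent of $n$, are uniquely determined. *)

(* Defs.v *)
From HB Require Import structures.
From mathcomp Require Import all_boot all_order all_fingroup all_algebra.
From mathcomp Require Import finmap monalg reals complex.

Set Implicit Arguments.
Unset Strict Implicit.
Unset Printing Implicit Defensive.

Import GRing.Theory GroupScope.
Local Open Scope ring_scope.

(* The group algebra F[G]: functions f on G, standing for \sum_x f(x) x, under
   convolution. {ffun G -> F} itself carries the pointwise product. *)

Definition groupAlg (F : fieldType) (G : finGroupType) := {ffun G -> F}.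
Identity Coercion groupAlg_ffun : groupAlg >-> finfun_of.

Section GroupAlgebra.
Variables (F : fieldType) (G : finGroupType).

HB.instance Definition _ := GRing.Lmodule.copy (groupAlg F G) {ffun G -> F^o}.

Definition conv (f g : groupAlg F G) : groupAlg F G :=
  [ffun x => \sum_y f y * g (y^-1 * x)%g].

Definition conv1 : groupAlg F G := [ffun x => (x == 1%g)%:R].

Lemma convA : associative conv.
Proof.
move=> f g h; apply/ffunP=> x; rewrite !ffunE.
under eq_bigr => y _ do rewrite ffunE mulr_sumr.
under [RHS]eq_bigr => y _ do rewrite ffunE mulr_suml.
rewrite [RHS]exchange_big /=; apply: eq_bigr => y _.
rewrite [RHS](reindex_inj (mulgI y)) /=; apply: eq_bigr => z _.
by rewrite mulrA mulKg invMg mulgA.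
Qed.

Lemma conv1f : left_id conv1 conv.
Proof.
move=> f; apply/ffunP=> x; rewrite !ffunE (bigD1 1%g) //= big1 => [|y ny1].
  by rewrite ffunE eqxx mul1r invg1 mul1g addr0.
by rewrite ffunE (negPf ny1) mul0r.
Qed.

Lemma convf1 : right_id conv1 conv.
Proof.
move=> f; apply/ffunP=> x; rewrite !ffunE (bigD1 x) //= big1 => [|y nyx].
  by rewrite ffunE mulVg eqxx mulr1 addr0.
by rewrite ffunE -eq_mulVg1 (negPf nyx) mulr0.
Qed.

Lemma convDl : left_distributive conv +%R.
Proof.
move=> f g h; apply/ffunP=> x; rewrite !ffunE -big_split.
by apply: eq_bigr => y _; rewrite ffunE mulrDl.
Qed.

Lemma convDr : right_distributive conv +%R.
Proof.
move=> f g h; apply/ffunP=> x; rewrite !ffunE -big_split.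
by apply: eq_bigr => y _; rewrite ffunE mulrDr.
Qed.

Lemma conv1_neq0 : conv1 != 0.
Proof. by apply/eqP=> /ffunP/(_ 1%g)/eqP; rewrite !ffunE eqxx oner_eq0. Qed.

HB.instance Definition _ := GRing.Zmodule_isNzRing.Build (groupAlg F G)
  convA conv1f convf1 convDl convDr conv1_neq0.

Lemma convZl (a : F) (f g : groupAlg F G) : a *: (f * g) = (a *: f) * g.
Proof.
apply/ffunP=> x; rewrite !ffunE scaler_sumr.
by apply: eq_bigr => y _; rewrite ffunE -mulrA.
Qed.

HB.instance Definition _ :=
  GRing.Lmodule_isLalgebra.Build F (groupAlg F G) convZl.

Lemma convZr (a : F) (f g : groupAlg F G) : a *: (f * g) = f * (a *: g).
Proof.
apply/ffunP=> x; rewrite !ffunE scaler_sumr.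
by apply: eq_bigr => y _; rewrite ffunE mulrCA.
Qed.

HB.instance Definition _ :=
  GRing.Lalgebra_isAlgebra.Build F (groupAlg F G) convZr.

(* The class algebra R(G), with the product inherited from F[G]. *)

Definition is_classfun : {pred groupAlg F G} :=
  [pred f : groupAlg F G |
    [forall x : G, forall y : G, f (x ^ y)%g == f x]].

Lemma is_classfunP (f : groupAlg F G) :
  reflect (forall x y, f (x ^ y)%g = f x) (f \in is_classfun).
Proof. by apply: (iffP forallP) => fJ x; apply/'forall_eqP. Qed.

Lemma is_classfun_subalg : GRing.subsemialg_closed is_classfun.
Proof.
split.
- apply/is_classfunP=> x y.
  by rewrite !ffunE -{1}(conj1g y) (inj_eq (conjg_inj y)).
- split=> [|f g /is_classfunP fJ /is_classfunP gJ].
    by apply/is_classfunP=> x y; rewrite !ffunE.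
  by apply/is_classfunP=> x y; rewrite !ffunE fJ gJ.
- move=> a f /is_classfunP fJ.
  by apply/is_classfunP=> x y; rewrite !ffunE fJ.
move=> f g /is_classfunP fJ /is_classfunP gJ; apply/is_classfunP=> x y.
rewrite !ffunE (reindex_inj (conjg_inj y)); apply: eq_bigr => z _.
by rewrite fJ -conjVg -conjMg gJ.
Qed.

HB.instance Definition _ :=
  GRing.isSubalgClosed.Build F (groupAlg F G) is_classfun is_classfun_subalg.

Record classAlg :=
  ClassFun { classfun :> groupAlg F G; _ : classfun \in is_classfun }.

HB.instance Definition _ := [isSub for classfun].
HB.instance Definition _ := [Choice of classAlg by <:].
HB.instance Definition _ := [SubChoice_isSubAlgebra of classAlg by <:].

End GroupAlgebra.

Arguments is_classfun {F G}.

Section CharacteristicFunction.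
Variables (F : fieldType) (G : finGroupType).

Definition conjClass := {c : {set G} | c \in classes [set: G]}.

Definition charfun (c : conjClass) : groupAlg F G :=
  [ffun x => (x \in val c)%:R].

Lemma charfun_class c : charfun c \in is_classfun.
Proof.
apply/is_classfunP=> x y; rewrite !ffunE; congr (_ %:R).
have /imsetP[z _ ->] := valP c.
have inG (w : G) : w \in [set: G] by rewrite inE.
by rewrite !(@class_sym _ [set: G]%G _ z) classGidl.
Qed.

Definition K_ (c : conjClass) : classAlg F G := ClassFun (charfun_class c).

End CharacteristicFunction.

(* Induction to G from a group H, regarded as a subgroup of G through an
   injective morphism iota. *)

Section Induction.
Variables (F : fieldType) (H G : finGroupType) (iota : H -> G).

Definition ind_fun (f : {ffun H -> F}) : groupAlg F G :=
  [ffun x => #|H|%:R^-1 * \sum_(y : G) \sum_(h | iota h == (x ^ y)%g) f h].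

Lemma ind_fun_class f : ind_fun f \in is_classfun.
Proof.
apply/is_classfunP=> x z; rewrite !ffunE; congr (_ * _).
rewrite [RHS](reindex_inj (mulgI z)) /=.
by apply: eq_bigr => y _; apply: eq_bigl => h; rewrite conjgM.
Qed.

Definition Ind f : classAlg F G := ClassFun (ind_fun_class f).

End Induction.

(* The wreath product Gamma_n, with product
     (g, s) (h, t) = (g s(h), s \o t)   where s(h)_i = h_(s^-1 i).
   In {perm 'I_n} the function s \o t is written t * s. *)

Definition wreath (gT : finGroupType) (n : nat) :=
  ({ffun 'I_n -> gT} * {perm 'I_n})%type.

Section Wreath.
Variables (gT : finGroupType) (n : nat).
Local Open Scope group_scope.

HB.instance Definition _ := Finite.on (wreath gT n).

Definition wreath_mul (x y : wreath gT n) : wreath gT n :=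
  ([ffun i => x.1 i * y.1 (x.2^-1 i)], y.2 * x.2).
Definition wreath_one : wreath gT n := ([ffun=> 1], 1).
Definition wreath_inv (x : wreath gT n) : wreath gT n :=
  ([ffun i => (x.1 (x.2 i))^-1], x.2^-1).

Lemma wreath_mulA : associative wreath_mul.
Proof.
move=> x y z; congr (_, _); rewrite /= ?mulgA //.
by apply/ffunP=> i; rewrite !ffunE invMg permM mulgA.
Qed.

Lemma wreath_mul1 : left_id wreath_one wreath_mul.
Proof.
case=> g s; congr (_, _); rewrite /= ?mulg1 //.
by apply/ffunP=> i; rewrite !ffunE mul1g invg1 perm1.
Qed.

Lemma wreath_mulV : left_inverse wreath_one wreath_inv wreath_mul.
Proof.
case=> g s; congr (_, _); rewrite /= ?mulgV //.
by apply/ffunP=> i; rewrite !ffunE invgK mulVg.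
Qed.

HB.instance Definition _ := Finite_isGroup.Build (wreath gT n)
  wreath_mulA wreath_mul1 wreath_mulV.

(* For i = i_1 on an r-cycle (i_1 i_2 .. i_r) of the permutation part of x,
   the product g_{i_r} .. g_{i_2} g_{i_1}. *)
Definition cycle_product (x : wreath gT n) (r : nat) (i : 'I_n) : gT :=
  \prod_(j <- rev (traject x.2 i r)) x.1 j.

Lemma cycle_productE (x : wreath gT n) r i :
  cycle_product x r i = (x ^+ r).1 (x.2^-1 (iter r x.2 i)).
Proof.
rewrite /cycle_product; elim: r => [|r IHr].
  by rewrite big_nil expg0 ffunE.
rewrite trajectSr rev_rcons big_cons IHr expgS /= ffunE.
by rewrite permK.
Qed.

Lemma expg_wreath2 (x : wreath gT n) r : (x ^+ r).2 = x.2 ^+ r.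
Proof. by elim: r => // r IHr; rewrite expgS expgSr /= IHr. Qed.

Lemma conjg_wreath2 (x y : wreath gT n) : (x ^ y).2 = x.2 ^ y.2^-1.
Proof. by rewrite [RHS]/conjg invgK mulgA. Qed.

Lemma conjg_wreath1 (a y : wreath gT n) i : a.2 = 1 ->
  (a ^ y).1 i = a.1 (y.2 i) ^ y.1 (y.2 i).
Proof.
by move=> a2; rewrite /conjg /= !ffunE /= a2 !invgK invg1 perm1.
Qed.

End Wreath.

Section Sigma.
Variables (F : fieldType) (gT : finGroupType).
Implicit Types (r n m : nat) (gamma : classAlg F gT).

(* The permutation part of x is an r-cycle iff some (equivalently, every)
   orbit of it is full; [pick ..] chooses i_1, on which the value does not
   depend as gamma is a class function. *)
Definition sigma_val r gamma (x : wreath gT r) : F :=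
  if [pick i | porbit x.2 i == [set: 'I_r]] is Some i
  then r%:R * gamma (cycle_product x r i) else 0.

Definition sigma_fun r gamma : groupAlg F (wreath gT r) :=
  [ffun x => sigma_val gamma x].

Lemma full_porbitE r (x : wreath gT r) i :
  porbit x.2 i = [set: 'I_r] -> (x.2 ^+ r)%g = 1%g.
Proof.
move=> xi; have r_def : #|porbit x.2 i| = r by rewrite xi cardsT card_ord.
apply/permP=> j; rewrite permX perm1 -[X in iter X]r_def.
have /eqP <- : porbit x.2 j == porbit x.2 i by rewrite eq_porbit_mem xi inE.
exact: iter_porbit.
Qed.

Lemma cycle_product_full r gamma (x y : wreath gT r) i j :
  porbit x.2 i = [set: 'I_r] ->
  gamma (cycle_product x r i) = gamma (cycle_product (x ^ y)%g r j).
Proof.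
move=> xi; have x2 := full_porbitE xi; have /is_classfunP gJ := valP gamma.
have a2 : (x ^+ r)%g.2 = 1%g by rewrite expg_wreath2.
have stepx k : gamma ((x ^+ r)%g.1 (x.2 k)) = gamma ((x ^+ r)%g.1 k).
  rewrite -[in RHS](_ : ((x ^+ r) ^ x)%g = (x ^+ r)%g).
    by rewrite conjg_wreath1 // gJ.
  by apply/conjg_fixP/commgP/commute_sym/commuteX.
have constx k : gamma ((x ^+ r)%g.1 k) = gamma ((x ^+ r)%g.1 i).
  have : k \in porbit x.2 i by rewrite xi inE.
  case/porbitP=> l ->; elim: l => [|l IHl]; first by rewrite perm1.
  by rewrite expgSr permM stepx.
by rewrite !cycle_productE -conjXg conjg_wreath1 // gJ !constx.
Qed.

Lemma full_porbitJ r (x y : wreath gT r) i :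
  porbit x.2 i = [set: 'I_r] -> porbit (x ^ y)%g.2 (y.2^-1%g i) = [set: 'I_r].
Proof.
move=> xi; apply/setP=> j; rewrite inE.
have : y.2 j \in porbit x.2 i by rewrite xi inE.
case/porbitP=> l yj; apply/porbitP; exists l.
by rewrite conjg_wreath2 -conjXg permJ -yj permK.
Qed.

Lemma sigma_fun_class r gamma : sigma_fun r gamma \in is_classfun.
Proof.
apply/is_classfunP=> x y; rewrite !ffunE /sigma_val.
case: pickP => [i /eqP xyi | noxy]; case: pickP => [j /eqP xj | nox] //.
- by rewrite (cycle_product_full gamma y i xj).
- have := full_porbitJ y^-1%g xyi; rewrite conjgK => xi.
  by have := nox (y^-1%g.2^-1%g i); rewrite xi eqxx.
by have := noxy (y.2^-1%g j); rewrite (full_porbitJ y xj) eqxx.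
Qed.

Definition sigma_ r gamma : classAlg F (wreath gT r) :=
  ClassFun (sigma_fun_class r gamma).

Lemma split_lshift n m (j : 'I_n) : split (lshift m j) = inl j.
Proof. exact: (unsplitK (inl j)). Qed.

Lemma split_rshift n m (k : 'I_m) : split (rshift n k) = inr k.
Proof. exact: (unsplitK (inr k)). Qed.

Definition embed_perm_fun n m (s : {perm 'I_n}) (t : {perm 'I_m})
    (i : 'I_(n + m)) : 'I_(n + m) :=
  match split i with inl j => lshift m (s j) | inr k => rshift n (t k) end.

Lemma embed_perm_inj n m (s : {perm 'I_n}) (t : {perm 'I_m}) :
  injective (embed_perm_fun s t).
Proof.
move=> i j; rewrite /embed_perm_fun; case: split_ordP => i' ->;
  case: split_ordP => j' -> /eqP; rewrite ?eq_shift // => /eqP/perm_inj-> //.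
Qed.

(* The inclusion of Gamma_n x Gamma_m into Gamma_(n + m). *)
Definition embed n m (x : (wreath gT n * wreath gT m)%type) :
    wreath gT (n + m) :=
  ([ffun i => match split i with inl j => x.1.1 j | inr k => x.2.1 k end],
   perm (@embed_perm_inj n m x.1.2 x.2.2)).

Lemma embed_perml n m (s : {perm 'I_n}) (t : {perm 'I_m}) j :
  perm (embed_perm_inj (s := s) (t := t)) (lshift m j) = lshift m (s j).
Proof. by rewrite permE /embed_perm_fun split_lshift. Qed.

Lemma embed_permr n m (s : {perm 'I_n}) (t : {perm 'I_m}) k :
  perm (embed_perm_inj (s := s) (t := t)) (rshift n k) = rshift n (t k).
Proof. by rewrite permE /embed_perm_fun split_rshift. Qed.

Lemma embedM n m : {morph @embed n m : x y / (x * y)%g}.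
Proof.
move=> [[g s] [g' s']] [[h t] [h' t']]; congr (_, _).
  apply/ffunP=> i; rewrite !ffunE /=; case: (split_ordP i) => j ->.
    set p := perm _; have -> : p^-1%g (lshift m j) = lshift m (s^-1%g j).
      by apply: (@perm_inj _ p); rewrite permKV embed_perml permKV.
    by rewrite !split_lshift ffunE.
  set p := perm _; have -> : p^-1%g (rshift n j) = rshift n (s'^-1%g j).
    by apply: (@perm_inj _ p); rewrite permKV embed_permr permKV.
  by rewrite !split_rshift ffunE.
apply/permP=> i; rewrite permM; case: (split_ordP i) => j ->.
  by rewrite !embed_perml permM.
by rewrite !embed_permr permM.
Qed.

Lemma embed_inj n m : injective (@embed n m).
Proof.
move=> [[g s] [g' s']] [[h t] [h' t']] e.
have egh i := congr1 (fun x : wreath gT (n + m) => x.1 i) e.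
have est i := congr1 (fun x : wreath gT (n + m) => x.2 i) e.
congr ((_, _), (_, _)); (apply/ffunP || apply/permP) => i.
- by have /= := egh (lshift m i); rewrite !ffunE split_lshift.
- apply: (@lshift_inj n m); have /= := est (lshift m i).
  by rewrite !embed_perml.
- by have /= := egh (rshift n i); rewrite !ffunE split_rshift.
apply: (@rshift_inj n m); have /= := est (rshift n i).
by rewrite !embed_permr.
Qed.

(* Homogeneous elements of the direct sum over n of the R(Gamma_n). *)
Definition homog := {n : nat & classAlg F (wreath gT n)}.

Definition inDegree n (v : classAlg F (wreath gT n)) : homog := existT _ n v.

(* The component in R(Gamma_n): v on [inDegree n v], and 0 on [inDegree m v]
   for m different from n. *)
Definition component n (u : homog) : classAlg F (wreath gT n) :=
  @untag nat (fun m => classAlg F (wreath gT m)) _ 0 n id u.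

Definition vacuum : homog := @inDegree 0%N 1.

(* p_{-r}(gamma) *)
Definition creation r gamma (u : homog) : homog :=
  inDegree (Ind (@embed r (tag u))
    [ffun h => sigma_ r gamma h.1 * tagged u h.2]).

End Sigma.

(* Partitions, as nonincreasing sequences of positive integers. *)
Record intpart :=
  IntPart { parts :> seq nat; _ : sorted geq parts && (0%N \notin parts) }.

HB.instance Definition _ := [isSub for parts].
HB.instance Definition _ := [Countable of intpart by <:].

Definition mult (r : nat) (lambda : intpart) : nat := count_mem r lambda.

Definition partFamily (gT : finGroupType) := {ffun conjClass gT -> intpart}.

Definition famsize gT (rho : partFamily gT) : nat :=
  (\sum_c sumn (rho c))%N.

Section Statement.
Variables (F : fieldType) (gT : finGroupType).
Implicit Types (n : nat) (rho : partFamily gT).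

(* No part of a rho c exceeds famsize rho, which thus bounds r. *)
Definition part_vector rho : homog F gT :=
  (\big[comp/id]_(c : conjClass gT) \big[comp/id]_(1 <= r < (famsize rho).+1)
     iter (mult r (rho c)) (creation r (K_ F c))) (vacuum F gT).

(* p_rho(n); the vector built here has degree n when famsize rho <= n. *)
Definition p_ rho n : classAlg F (wreath gT n) :=
  if (famsize rho <= n)%N then
    ((n - famsize rho)`!%:R)^-1 *:
      component n (iter (n - famsize rho) (creation 1%N 1) (part_vector rho))
  else 0.

(* The linear extension of a family of vectors b indexed by partFamily to the
   vector space with basis partFamily. *)
Definition lincomb (V : lmodType F) (b : partFamily gT -> V)
    (x : {malg F[partFamily gT]}) : V :=
  \sum_(nu <- msupp x) x@_nu *: b nu.

(* The constant d_{rho sigma}^nu is the coefficient (d rho sigma)@_nu. *)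
Definition structure_constants
    (d : partFamily gT -> partFamily gT -> {malg F[partFamily gT]}) : Prop :=
  (forall rho sigma nu, nu \in msupp (d rho sigma) ->
     (famsize nu <= famsize rho + famsize sigma)%N) /\
  (forall n rho sigma, (0 < n)%N ->
     p_ rho n * p_ sigma n = lincomb (p_^~ n) (d rho sigma)).

End Statement.

(* Main.v *)
Require Import Defs.
From HB Require Import structures.
From mathcomp Require Import all_boot all_order all_fingroup all_algebra.
From mathcomp Require Import finmap monalg reals complex.
From mathcomp Require Import ring.
From mathcomp Require boolp.

(* Gamma_n acts on [n] x Gamma, and a Gamma-equivariant injection phi of
   [k] x Gamma into [n] x Gamma (a "labelled injection") carries x in Gamma_k to
   an element of Gamma_n that is trivial off the image of phi. Let P_x(n) be the
   sum of these elements over all phi. If x has cycle type rho, with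
   k = ||rho||, then p_rho(n) = kappa P_x(n) for a nonzero kappa which does not
   depend on n. A pair of labelled injections into n factors through the union
   of the two images, so sorting the terms of P_x(n) * P_y(n) by this union
   expresses the product as a combination of sums P_u(n), with coefficients
   independent of n. For uniqueness, a vanishing combination of the p_nu(n),
   evaluated at n = ||nu|| for nu of least size in its support, has coefficient 0
   at nu; the case n = 0 follows from n > 0, as p_nu(n) takes at the identity a
   value polynomial in n. The axioms of the stable algebra then hold because the
   specializations at all n > 0 are jointly injective. *)

Set Implicit Arguments.
Unset Strict Implicit.
Unset Printing Implicit Defensive.

Import GRing.Theory Num.Theory.
Local Open Scope ring_scope.

Lemma pick_preim (A B : finType) (f : A -> B) : injective f ->
  forall j, [pick i | f i == f j] = Some j.
Proof.
move=> injf j; case: pickP => [i /eqP/injf -> // | /(_ j)].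
by rewrite eqxx.
Qed.

Lemma inj_perm_extend k n (f g : 'I_k -> 'I_n) : injective f -> injective g ->
  exists s : {perm 'I_n}, forall j, s (f j) = g j.
Proof.
move=> injf injg.
suff: forall l, (l <= k)%N -> exists s : {perm 'I_n},
    forall j : 'I_k, (j < l)%N -> s (f j) = g j.
  by case/(_ k (leqnn _)) => s sP; exists s => j; apply: sP.
elim=> [|l IHl] ltlk; first by exists 1%g.
have [s sP] := IHl (ltnW ltlk); pose i := Ordinal ltlk.
exists (s * tperm (s (f i)) (g i))%g => j; rewrite permM ltnS leq_eqVlt.
have [ji _ | neji /= ltjl] := eqVneq (val j) l.
  by have -> : j = i; [apply: val_inj | rewrite tpermL].
have neji' : i != j by apply: contraNneq neji => <-.
rewrite tpermD.
- exact: sP.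
- by rewrite (inj_eq perm_inj) (inj_eq injf).
by rewrite sP // (inj_eq injg).
Qed.

(** * Labelled injections and the push-forward of wreath product elements *)

Section LabelledInjections.
Variable gT : finGroupType.
Local Open Scope group_scope.
Implicit Types k n m : nat.

(* The label picked up on the step i -> x.2 i: in the action of Gamma_n on
   [n] x Gamma, x maps (i, g) to (x.2 i, steplab x i * g). *)
Definition steplab n (x : wreath gT n) i := x.1 (x.2 i).

Lemma wreathP n (x y : wreath gT n) :
  x.2 =1 y.2 -> steplab x =1 steplab y -> x = y.
Proof.
case: x y => [g s] [h t] /= /permP <- eq1; congr (_, _).
by apply/ffunP=> i; have := eq1 (s^-1 i); rewrite /steplab /= permKV.
Qed.

Lemma wreathM2 n (x y : wreath gT n) i : (x * y).2 i = x.2 (y.2 i).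
Proof. by rewrite permM. Qed.

Lemma steplabM n (x y : wreath gT n) i :
  steplab (x * y) i = steplab x (y.2 i) * steplab y i.
Proof. by rewrite /steplab /= ffunE permM permK. Qed.

Lemma wreath1_2 n i : (1 : wreath gT n).2 i = i.
Proof. exact: perm1. Qed.

Lemma steplab1 n i : steplab (1 : wreath gT n) i = 1.
Proof. by rewrite /steplab ffunE. Qed.

Definition mkwreath n (s : {perm 'I_n}) (l : 'I_n -> gT) : wreath gT n :=
  ([ffun i => l (s^-1 i)], s).

Lemma steplab_mkwreath n (s : {perm 'I_n}) l i : steplab (mkwreath s l) i = l i.
Proof. by rewrite /steplab ffunE permK. Qed.

(** The pair [(f, h)] encodes the map (j, g) -> (f j, h j * g). Every injection of [k] x Gamma into
    [n] x Gamma that commutes with right multiplication on Gamma has this form. *)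
Definition linj k n :=
  ({f : {ffun 'I_k -> 'I_n} | injectiveb f} * {ffun 'I_k -> gT})%type.
HB.instance Definition _ k n := Finite.on (linj k n).

Definition pos k n (phi : linj k n) : 'I_k -> 'I_n := val phi.1.
Definition lab k n (phi : linj k n) : 'I_k -> gT := phi.2.

Lemma pos_inj k n (phi : linj k n) : injective (pos phi).
Proof. by case: phi => [[f injf] h]; apply/injectiveP. Qed.

Lemma mkinj_subproof k n (f : 'I_k -> 'I_n) :
  injective f -> injectiveb [ffun j => f j].
Proof. by move=> injf; apply/injectiveP=> i j; rewrite !ffunE => /injf. Qed.

Definition mklinj k n f (injf : injective f) h : linj k n :=
  (exist (fun f : {ffun _ -> _} => injectiveb f) _ (mkinj_subproof injf),
   [ffun j => h j]).

Lemma pos_mk k n f injf h : pos (@mklinj k n f injf h) =1 f.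
Proof. by move=> j; rewrite /pos ffunE. Qed.

Lemma lab_mk k n f injf h : lab (@mklinj k n f injf h) =1 h.
Proof. by move=> j; rewrite /lab ffunE. Qed.

Lemma linjP k n (phi psi : linj k n) :
  pos phi =1 pos psi -> lab phi =1 lab psi -> phi = psi.
Proof.
case: phi psi => [f h] [g l] eqf eqh.
by congr (_, _); [apply: val_inj|]; apply/ffunP.
Qed.

Lemma card_wreath n : #|{: wreath gT n}| = (#|gT| ^ n * n`!)%N.
Proof. by rewrite card_prod card_ffun !card_ord card_Sn. Qed.

Lemma card_linj k n : #|{: linj k n}| = (n ^_ k * #|gT| ^ k)%N.
Proof.
rewrite card_prod card_sig card_ffun !card_ord; congr (_ * _)%N.
by rewrite -[k in RHS]card_ord -[n in RHS]card_ord -card_inj_ffuns cardsE.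
Qed.

Lemma notin_posP k n (phi : linj k n) i :
  reflect (forall j, pos phi j != i) (i \notin codom (pos phi)).
Proof.
apply: (iffP idP) => [ni j | nj].
  by apply: contraNneq ni => <-; apply: codom_f.
by apply/codomP=> -[j /eqP]; rewrite eq_sym (negPf (nj j)).
Qed.

(** As maps on [k] x Gamma this says $u \circ \phi = \phi \circ a$, split into positions and
    labels. *)
Definition intertwines k n (phi : linj k n) (a : wreath gT k) (u : wreath gT n)
  := forall j, u.2 (pos phi j) = pos phi (a.2 j) /\
     steplab u (pos phi j) * lab phi j = lab phi (a.2 j) * steplab a j.

Definition trivial_off k n (phi : linj k n) (u : wreath gT n) :=
  forall i, i \notin codom (pos phi) -> u.2 i = i /\ steplab u i = 1.

Lemma intertwines_uniq k n (phi : linj k n) a u v :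
  intertwines phi a u -> trivial_off phi u ->
  intertwines phi a v -> trivial_off phi v -> u = v.
Proof.
move=> Iu Tu Iv Tv; apply: wreathP => i;
  have [/codomP[j ->] | ni] := boolP (i \in codom (pos phi)).
- by rewrite (Iu j).1 (Iv j).1.
- by rewrite (Tu i ni).1 (Tv i ni).1.
- by apply: (mulIg (lab phi j)); rewrite (Iu j).2 (Iv j).2.
by rewrite (Tu i ni).2 (Tv i ni).2.
Qed.

Lemma intertwinesM k n (phi : linj k n) a b u v :
  intertwines phi a u -> intertwines phi b v -> intertwines phi (a * b) (u * v).
Proof.
move=> Ia Ib j; rewrite !wreathM2 !steplabM (Ib j).1 (Ia _).1; split=> //.
by rewrite -mulgA (Ib j).2 mulgA (Ia _).2 mulgA.
Qed.

Lemma trivial_offM k n (phi : linj k n) u v :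
  trivial_off phi u -> trivial_off phi v -> trivial_off phi (u * v).
Proof.
move=> Tu Tv i ni; rewrite wreathM2 steplabM (Tv i ni).1 (Tv i ni).2.
by rewrite (Tu i ni).1 (Tu i ni).2 mulg1.
Qed.

Lemma intertwines1 k n (phi : linj k n) : intertwines phi 1 1.
Proof. by move=> j; rewrite !wreath1_2 !steplab1 mulg1 mul1g. Qed.

Lemma trivial_off1 k n (phi : linj k n) : trivial_off phi 1.
Proof. by move=> i; rewrite wreath1_2 steplab1. Qed.

Lemma intertwinesX k n (phi : linj k n) a u m :
  intertwines phi a u -> intertwines phi (a ^+ m) (u ^+ m).
Proof.
move=> Ia; elim: m => [|m IHm]; first exact: intertwines1.
by rewrite !expgS; apply: intertwinesM.
Qed.

Definition push_fun k n (phi : linj k n) (a : wreath gT k) i :=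
  if [pick j | pos phi j == i] is Some j then pos phi (a.2 j) else i.

Lemma push_fun_inj k n (phi : linj k n) a : injective (push_fun phi a).
Proof.
have pf j : push_fun phi a (pos phi j) = pos phi (a.2 j).
  by rewrite /push_fun (pick_preim (@pos_inj _ _ phi)).
have pout i : i \notin codom (pos phi) -> push_fun phi a i = i.
  by move=> /notin_posP ni; rewrite /push_fun; case: pickP => // j; rewrite (negPf (ni j)).
move=> i i'; have [/codomP[j ->]|ni] := boolP (i \in codom (pos phi));
  have [/codomP[j' ->]|ni'] := boolP (i' \in codom (pos phi)).
- by rewrite !pf => /pos_inj/perm_inj->.
- by rewrite pf pout // => e; move: ni'; rewrite -e codom_f.
- by rewrite pf pout // => e; move: ni; rewrite e codom_f.
by rewrite !pout.
Qed.

Definition push k n (phi : linj k n) (a : wreath gT k) : wreath gT n :=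
  mkwreath (perm (@push_fun_inj k n phi a)) (fun i =>
    if [pick j | pos phi j == i] is Some j
    then lab phi (a.2 j) * steplab a j * (lab phi j)^-1 else 1).

Lemma push_intertwines k n (phi : linj k n) a : intertwines phi a (push phi a).
Proof.
move=> j; rewrite steplab_mkwreath /= permE /push_fun.
by rewrite (pick_preim (@pos_inj _ _ phi)) mulgKV.
Qed.

Lemma push_trivial_off k n (phi : linj k n) a : trivial_off phi (push phi a).
Proof.
move=> i /notin_posP ni; rewrite steplab_mkwreath /= permE /push_fun.
by case: pickP => // j; rewrite (negPf (ni j)).
Qed.

(** Intertwining determines [u] on the image of [phi], and triviality determines it elsewhere.
    Several identities about [push] are proved below by checking these two properties. *)
Lemma push_uniq k n (phi : linj k n) a u :
  intertwines phi a u -> trivial_off phi u -> push phi a = u.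
Proof.
move=> Iu Tu; apply: (intertwines_uniq _ _ Iu Tu).
  exact: push_intertwines.
exact: push_trivial_off.
Qed.

Lemma pushM k n (phi : linj k n) : {morph push phi : a b / a * b}.
Proof.
move=> a b; apply: push_uniq.
  by apply: intertwinesM; apply: push_intertwines.
by apply: trivial_offM; apply: push_trivial_off.
Qed.

Lemma push1 k n (phi : linj k n) : push phi 1 = 1.
Proof. by apply: push_uniq; [apply: intertwines1 | apply: trivial_off1]. Qed.

Lemma push_inj k n (phi : linj k n) : injective (push phi).
Proof.
move=> a b eab; have Ia := push_intertwines phi a.
have Ib := push_intertwines phi b; rewrite -eab in Ib.
have eq2 j : a.2 j = b.2 j by apply: (@pos_inj _ _ phi); rewrite -(Ia j).1 (Ib j).1.
apply: wreathP => // j; apply: (mulgI (lab phi (a.2 j))).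
by rewrite -(Ia j).2 eq2 (Ib j).2.
Qed.

Lemma push_inj1 k n (phi : linj k n) a : (push phi a == 1) = (a == 1).
Proof. by rewrite -(push1 phi) (inj_eq (@push_inj _ _ phi)). Qed.

Lemma lcomp_inj k m n (theta : linj m n) (alpha : linj k m) :
  injective (pos theta \o pos alpha).
Proof. by apply: inj_comp; apply: pos_inj. Qed.

Definition lcomp k m n (theta : linj m n) (alpha : linj k m) : linj k n :=
  mklinj (@lcomp_inj k m n theta alpha)
         (fun j => lab theta (pos alpha j) * lab alpha j).

Lemma pos_lcomp k m n (theta : linj m n) (alpha : linj k m) j :
  pos (lcomp theta alpha) j = pos theta (pos alpha j).
Proof. exact: pos_mk. Qed.

Lemma lab_lcomp k m n (theta : linj m n) (alpha : linj k m) j :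
  lab (lcomp theta alpha) j = lab theta (pos alpha j) * lab alpha j.
Proof. exact: lab_mk. Qed.

Lemma intertwines_lcomp k m n (theta : linj m n) (alpha : linj k m) a b u :
  intertwines alpha a b -> intertwines theta b u ->
  intertwines (lcomp theta alpha) a u.
Proof.
move=> Ia It j; rewrite !pos_lcomp !lab_lcomp (It _).1 (Ia _).1; split=> //.
by rewrite mulgA (It _).2 -mulgA (Ia _).2 !mulgA (Ia _).1.
Qed.

Lemma push_lcomp k m n (theta : linj m n) (alpha : linj k m) a :
  push (lcomp theta alpha) a = push theta (push alpha a).
Proof.
apply: push_uniq.
  by apply: intertwines_lcomp; apply: push_intertwines.
(* A point missed by the composite either lies outside the image of [theta], or is the image under
   [theta] of a point missed by [alpha]. *)
move=> i; have [/codomP[j ->] | ni _] := boolP (i \in codom (pos theta)).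
  move/notin_posP=> nj; have [-> e2] := push_intertwines theta (push alpha a) j.
  have nj' : j \notin codom (pos alpha).
    apply/notin_posP=> l; apply: contraNneq (nj l) => <-.
    by rewrite pos_lcomp.
  have [e3 e4] := push_trivial_off a nj'.
  split; first by rewrite e3.
  by apply: (mulIg (lab theta j)); rewrite e2 e3 e4 mulg1 mul1g.
exact: push_trivial_off.
Qed.

Lemma lcompA k l m n (theta : linj m n) (alpha : linj l m) (beta : linj k l) :
  lcomp theta (lcomp alpha beta) = lcomp (lcomp theta alpha) beta.
Proof.
apply: linjP => j; first by rewrite !pos_lcomp.
by rewrite !(pos_lcomp, lab_lcomp) mulgA.
Qed.

Lemma lcomp_injl k m n (theta : linj m n) :
  injective (fun alpha : linj k m => lcomp theta alpha).
Proof.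
move=> alpha beta e.
have epos : pos alpha =1 pos beta.
  by move=> j; apply: (@pos_inj _ _ theta); rewrite -!pos_lcomp e.
apply: linjP => // j; apply: (mulgI (lab theta (pos alpha j))).
by rewrite -lab_lcomp e lab_lcomp epos.
Qed.

Definition linj_of n (z : wreath gT n) : linj n n :=
  mklinj (@perm_inj _ z.2) (steplab z).

Lemma intertwines_linj_of n (z a : wreath gT n) :
  intertwines (linj_of z) a (z * a * z^-1).
Proof.
move=> j; rewrite !pos_mk !lab_mk; have e : z * a = z * a * z^-1 * z.
  by rewrite mulgKV.
by split; [rewrite -wreathM2 -e wreathM2 | rewrite -steplabM -e steplabM].
Qed.

(** The action of [z] on [n] x Gamma is itself a labelled injection. The exponent is inverted
    because [a ^ z] means $z^{-1} a z$. *)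
Lemma push_linj_of n (z a : wreath gT n) : push (linj_of z) a = a ^ z^-1.
Proof.
rewrite conjgE invgK mulgA; apply: push_uniq; first exact: intertwines_linj_of.
move=> i /notin_posP/(_ (z.2^-1 i)).
by rewrite pos_mk permKV eqxx.
Qed.

Lemma linj_ofM n (z w : wreath gT n) :
  linj_of (z * w) = lcomp (linj_of z) (linj_of w).
Proof.
apply: linjP => j; first by rewrite pos_lcomp !pos_mk wreathM2.
by rewrite lab_lcomp !(lab_mk, pos_mk) steplabM.
Qed.

(** Transitivity of Gamma_n on labelled injections: a permutation matches the positions, and the
    quotients of the labels serve as its step labels. *)
Lemma linj_trans k n (phi psi : linj k n) :
  exists z, lcomp (linj_of z) phi = psi.
Proof.
have [s sP] := inj_perm_extend (@pos_inj _ _ phi) (@pos_inj _ _ psi).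
exists (mkwreath s (fun i => if [pick j | pos phi j == i] is Some j
                             then lab psi j * (lab phi j)^-1 else 1)).
apply: linjP => j; first by rewrite pos_lcomp !pos_mk sP.
rewrite lab_lcomp lab_mk steplab_mkwreath.
by rewrite (pick_preim (@pos_inj _ _ phi)) mulgKV.
Qed.

Definition pimg k n (phi : linj k n) : {set 'I_n} := pos phi @: [set: 'I_k].

Lemma pimg_lcomp k m n (theta : linj m n) (alpha : linj k m) :
  pimg (lcomp theta alpha) = pos theta @: pimg alpha.
Proof.
rewrite /pimg -imset_comp; apply: eq_imset => j /=.
by rewrite pos_lcomp.
Qed.

Lemma card_pimg k n (phi : linj k n) : #|pimg phi| = k.
Proof. by rewrite card_imset ?cardsT ?card_ord //; apply: pos_inj. Qed.

Lemma lcomp_factor k m n (theta : linj m n) (phi : linj k n) :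
  pimg phi \subset pimg theta -> exists alpha, lcomp theta alpha = phi.
Proof.
move=> /subsetP sub.
have ex j : exists l, pos theta l == pos phi j.
  have /imsetP[l _ ->] : pos phi j \in pimg theta by apply/sub/imset_f; rewrite inE.
  by exists l.
pose g j := xchoose (ex j).
have gP j : pos theta (g j) = pos phi j by apply/eqP/(xchooseP (ex j)).
have injg : injective g.
  by move=> i j e; apply: (@pos_inj _ _ phi); rewrite -!gP e.
exists (mklinj injg (fun j => (lab theta (g j))^-1 * lab phi j)).
apply: linjP => j; first by rewrite pos_lcomp pos_mk gP.
by rewrite lab_lcomp lab_mk pos_mk mulKVg.
Qed.

(** For |D| = m, the positions can be arranged in m! ways and the labels are free, which gives the
    order of Gamma_m. *)
Lemma card_linj_pimg m n (D : {set 'I_n}) :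
  #|[set theta : linj m n | pimg theta == D]|
  = if #|D| == m then #|{: wreath gT m}| else 0%N.
Proof.
case: eqP => [Dm | neDm]; last first.
  apply: eq_card0 => theta; rewrite inE; apply/negbTE/eqP => e.
  by apply: neDm; rewrite -e card_pimg.
have -> : [set theta : linj m n | pimg theta == D]
  = setX [set f : {f : {ffun 'I_m -> 'I_n} | injectiveb f} |
           val f \in ffun_on (mem D)] setT.
  apply/setP=> theta; rewrite !inE andbT; apply/eqP/ffun_onP => [<- j | tD].
    by apply: imset_f; rewrite inE.
  apply/eqP; rewrite eqEcard card_pimg Dm leqnn andbT.
  by apply/subsetP=> _ /imsetP[j _ ->]; apply: tD.
rewrite cardsX cardsT card_ffun !card_ord card_wreath mulnC; congr (_ * _)%N.
rewrite -(card_imset _ val_inj).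
have -> : [set val f | f in [set f : {f : {ffun 'I_m -> 'I_n} | injectiveb f} |
           val f \in ffun_on (mem D)]]
   = [set f in ffun_on (mem D) | injectiveb (f : {ffun 'I_m -> 'I_n})].
  apply/setP=> f; rewrite inE; apply/imsetP/andP => [[g] | [fD injf]].
    by rewrite inE => gD ->; split; rewrite ?(valP g).
  by exists (exist (fun f : {ffun 'I_m -> 'I_n} => injectiveb f) f injf); rewrite ?inE.
by rewrite card_inj_ffuns_on card_ord Dm ffactnn.
Qed.

End LabelledInjections.

(** * Sums over labelled injections and over pairs of them *)

Section LinjSums.
Variables (gT : finGroupType) (F : numFieldType) (V : lmodType F).

Lemma natr_group_neq0 (G : finGroupType) : #|G|%:R != 0 :> F.
Proof. by rewrite pnatr_eq0 -lt0n; apply/card_gt0P; exists 1%g. Qed.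

(** The double sum of $G(z\phi)$ is computed in two orders: by transitivity the sum over [z] is the
    same for all [phi], while each [z] permutes the labelled injections. *)
Lemma sum_linj_orbit k n (G : linj gT k n -> V) (iota : linj gT k n) :
  #|{: linj gT k n}|%:R *: (\sum_(z : wreath gT n) G (lcomp (linj_of z) iota))
  = #|{: wreath gT n}|%:R *: \sum_phi G phi.
Proof.
have indep (phi : linj gT k n) :
    \sum_z G (lcomp (linj_of z) phi) = \sum_z G (lcomp (linj_of z) iota).
  have [w <-] := linj_trans iota phi.
  under eq_bigr => z _ do rewrite lcompA -linj_ofM.
  by rewrite [RHS](reindex_inj (mulIg w)).
transitivity (\sum_phi \sum_z G (lcomp (linj_of z) phi)).
  under [RHS]eq_bigr => phi _ do rewrite indep.
  by rewrite sumr_const scaler_nat.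
rewrite exchange_big /= scaler_nat -sumr_const; apply: eq_bigr => z _.
by rewrite [RHS](reindex_inj (@lcomp_injl gT k n n (linj_of z))).
Qed.

Definition jsurj k l m (ab : linj gT k m * linj gT l m) :=
  pimg ab.1 :|: pimg ab.2 == [set: 'I_m].

(** Composition with [theta] is injective, and a pair factors through [theta] when both images lie
    in that of [theta]. Joint surjectivity then becomes equality of the union with this image. *)
Lemma sum_jsurj k l m n (theta : linj gT m n)
    (G : linj gT k n * linj gT l n -> V) :
  \sum_(ab | jsurj ab) G (lcomp theta ab.1, lcomp theta ab.2)
  = \sum_(p | pimg p.1 :|: pimg p.2 == pimg theta) G p.
Proof.
pose h (ab : linj gT k m * linj gT l m) :=
  (lcomp theta ab.1, lcomp theta ab.2).
have injh : injective h.
  move=> [a b] [c d] e; have /lcomp_injl /= -> := congr1 fst e.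
  by have /lcomp_injl /= -> := congr1 snd e.
have -> : \sum_(p | pimg p.1 :|: pimg p.2 == pimg theta) G p
        = \sum_(p in h @: [set ab | jsurj ab]) G p.
  apply: eq_bigl => -[phi psi] /=; apply/eqP/imsetP => [e | [[a b]]].
    have [a aE] : exists a, lcomp theta a = phi.
      by apply: lcomp_factor; rewrite -e subsetUl.
    have [b bE] : exists b, lcomp theta b = psi.
      by apply: lcomp_factor; rewrite -e subsetUr.
    exists (a, b); last by rewrite /h /= aE bE.
    rewrite inE /jsurj /= -(inj_eq (imset_inj (@pos_inj _ _ _ theta))).
    by rewrite imsetU -!pimg_lcomp aE bE e.
  rewrite inE /jsurj /= => /eqP ab /[dup] /(congr1 fst) /= -> /(congr1 snd) /= ->.
  by rewrite !pimg_lcomp -imsetU ab.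
rewrite big_imset /=; last by move=> x y _ _ /injh.
by apply: eq_bigl => ab; rewrite inE.
Qed.

(** A pair whose images have union [D] factors through each [theta] with image [D], and there are
    |Gamma_m| of these for m = |D|, which is at most k + l. Dividing by this number counts each pair
    once. *)
Lemma sum_linj_pairs k l n (G : linj gT k n * linj gT l n -> V) :
  \sum_p G p = \sum_(m < (k + l).+1) #|{: wreath gT m}|%:R^-1 *:
    \sum_(ab : linj gT k m * linj gT l m | jsurj ab) \sum_(theta : linj gT m n)
      G (lcomp theta ab.1, lcomp theta ab.2).
Proof.
under [RHS]eq_bigr => m _.
  rewrite exchange_big /=.
  under eq_bigr => theta _ do rewrite sum_jsurj.
  rewrite (exchange_big_dep predT) //= scaler_sumr.
  over.
rewrite exchange_big /=; apply: eq_bigr => p _.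
set D := _ :|: _.
have DP : (#|D| < (k + l).+1)%N.
  by rewrite ltnS (leq_trans (leq_card_setU _ _)) ?leq_add ?card_pimg.
have cnt (m : nat) : \sum_(theta : linj gT m n | D == pimg theta) G p
    = (if #|D| == m then #|{: wreath gT m}| else 0%N)%:R *: G p.
  rewrite -card_linj_pimg scaler_nat -sumr_const; apply: eq_bigl => theta.
  by rewrite inE eq_sym.
rewrite (bigD1 (Ordinal DP)) //= cnt eqxx scalerA mulVf ?scale1r; last first.
  exact: natr_group_neq0.
rewrite big1 ?addr0 // => m; rewrite -val_eqE /= eq_sym => /negPf neq.
by rewrite cnt neq scale0r scaler0.
Qed.
End LinjSums.

(** * Point masses, orbit sums and their induction *)

Section Delta.
Variables (F : numFieldType) (G : finGroupType).

Definition delta (x : G) : groupAlg F G := [ffun y => (y == x)%:R].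

Lemma deltaM x y : delta x * delta y = delta (x * y)%g.
Proof.
apply/ffunP=> z; rewrite !ffunE (bigD1 x) //= big1 ?addr0 => [|w nw].
  by rewrite !ffunE eqxx mul1r -(inj_eq (mulgI x)) mulKVg.
by rewrite ffunE (negPf nw) mul0r.
Qed.

Lemma sum_groupAlgE I (r : seq I) (P : pred I) (f : I -> groupAlg F G) x :
  (\sum_(i <- r | P i) f i) x = \sum_(i <- r | P i) f i x.
Proof. exact: sum_ffunE. Qed.

Lemma groupAlgZE (a : F) (f : groupAlg F G) x : (a *: f) x = a * f x.
Proof. by rewrite ffunE. Qed.

(** Conjugates are counted with multiplicity, so this is the indicator of the class of [x] times the
    order of the centralizer of [x]. *)
Definition orbsum (x : G) : groupAlg F G := \sum_(z : G) delta (x ^ z)%g.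

Lemma orbsumE x y : orbsum x y = \sum_z (y == x ^ z)%g%:R.
Proof. by rewrite sum_groupAlgE; apply: eq_bigr => z _; rewrite ffunE. Qed.

Lemma orbsumJ x z : orbsum (x ^ z)%g = orbsum x.
Proof.
rewrite /orbsum [RHS](reindex_inj (mulgI z)) /=.
by apply: eq_bigr => w _; rewrite conjgM.
Qed.

Lemma orbsum_class x : orbsum x \in is_classfun.
Proof.
apply/is_classfunP=> y z; rewrite !orbsumE (reindex_inj (mulIg z)) /=.
by apply: eq_bigr => w _; rewrite conjgM (inj_eq (conjg_inj z)).
Qed.

Definition orbsumC (x : G) : classAlg F G := ClassFun (orbsum_class x).

Lemma orbsumCJ x z : orbsumC (x ^ z)%g = orbsumC x.
Proof. by apply: val_inj; apply: orbsumJ. Qed.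

Lemma classAlgP (f g : classAlg F G) : (forall x, f x = g x) -> f = g.
Proof. by move=> fg; apply: val_inj; apply/ffunP. Qed.

Lemma classfunZ (a : F) (f : classAlg F G) : classfun (a *: f) = a *: classfun f.
Proof. by []. Qed.

Lemma classfunM (f g : classAlg F G) :
  classfun (f * g) = classfun f * classfun g.
Proof. by []. Qed.

Lemma classfun_sum I (r : seq I) (P : pred I) (f : I -> classAlg F G) :
  classfun (\sum_(i <- r | P i) f i) = \sum_(i <- r | P i) classfun (f i).
Proof. exact: (raddf_sum (val : classAlg F G -> groupAlg F G)). Qed.

Lemma classfun_orbsum (f : classAlg F G) :
  f = #|G|%:R^-1 *: \sum_x f x *: orbsumC x.
Proof.
apply: classAlgP => y; rewrite classfunZ classfun_sum groupAlgZE sum_groupAlgE.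
have -> : \sum_x classfun (f x *: orbsumC x) y = \sum_(z : G) f y.
  transitivity (\sum_x \sum_z f x * (y == x ^ z)%g%:R).
    by apply: eq_bigr => x _; rewrite classfunZ groupAlgZE orbsumE mulr_sumr.
  rewrite exchange_big /=; apply: eq_bigr => z _.
  rewrite (bigD1 (y ^ z^-1)%g) //= conjgKV eqxx mulr1 big1 ?addr0 => [|x nx].
    by have /is_classfunP -> := valP f.
  case: eqP => [e | _]; last by rewrite mulr0.
  by case/eqP: nx; rewrite e conjgK.
rewrite sumr_const -[f y *+ _]mulr_natl.
by rewrite mulKf ?natr_group_neq0.
Qed.
End Delta.

Section IndOrbsum.
Variables (F : numFieldType) (H G : finGroupType) (iota : H -> G).

(** Conjugation by an element of [H] is absorbed by translating the summation variable over [G]. All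
    |H| of them contribute the same sum, and the factor 1/|H| cancels. *)
Lemma ind_orbsum (h : H) : injective iota -> {morph iota : x y / (x * y)%g} ->
  Ind iota (orbsum F h) = orbsumC F (iota h).
Proof.
move=> injI iotaM; have iota1 : iota 1%g = 1%g.
  by apply: (mulgI (iota 1%g)); rewrite -iotaM !mulg1.
have iotaV x : iota x^-1%g = (iota x)^-1%g.
  by apply: (mulgI (iota x)); rewrite -iotaM !mulgV.
have iotaJ x y : iota (x ^ y)%g = (iota x ^ iota y)%g.
  by rewrite !conjgE !iotaM iotaV.
apply: classAlgP => x; rewrite ffunE /= orbsumE.
have -> : \sum_y \sum_(h' | iota h' == (x ^ y)%g) orbsum F h h'
   = \sum_(z : H) \sum_y (x == iota h ^ y)%g%:R.
  transitivity (\sum_y \sum_(z : H) (x ^ y == iota (h ^ z))%g%:R : F).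
    apply: eq_bigr => y _; under eq_bigr => h' _ do rewrite orbsumE.
    rewrite exchange_big /=; apply: eq_bigr => z _.
    rewrite big_mkcond (bigD1 (h ^ z)%g) //= eqxx big1 ?addr0 => [|h' nh].
      by rewrite eq_sym; case: eqP.
    by rewrite (negPf nh); case: ifP.
  rewrite exchange_big /=; apply: eq_bigr => z _.
  rewrite (reindex_inj (mulIg (iota z))) /=.
  rewrite [RHS](reindex_inj invg_inj) /=; apply: eq_bigr => y _.
  rewrite iotaJ conjgM (inj_eq (conjg_inj _)).
  by rewrite -(inj_eq (conjg_inj y^-1%g)) conjgK.
by rewrite sumr_const -[X in _ * X]mulr_natl mulKf ?natr_group_neq0.
Qed.
End IndOrbsum.

(** * The sums P_x(n) and their products *)

Section LinjVectors.
Variables (F : numFieldType) (gT : finGroupType).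
Implicit Types k l m n : nat.

(** This is P_x(n). The argument [n] comes last because these sums are treated as families indexed
    by [n]. *)
Definition linj_sum k (x : wreath gT k) n : groupAlg F (wreath gT n) :=
  \sum_(phi : linj gT k n) delta F (push phi x).

(** When both injections factor through [theta], the two elements are already multiplied inside
    Gamma_m. Neither the coefficients nor the pairs [ab] involve [n]. *)
Lemma linj_sumM k l (x : wreath gT k) (y : wreath gT l) n :
  linj_sum x n * linj_sum y n = \sum_(m < (k + l).+1)
    #|{: wreath gT m}|%:R^-1 *: \sum_(ab : linj gT k m * linj gT l m | jsurj ab)
      linj_sum (push ab.1 x * push ab.2 y)%g n.
Proof.
rewrite /linj_sum big_distrlr /= pair_bigA /=.
rewrite (sum_linj_pairs (fun p : linj gT k n * linj gT l n =>
  delta F (push p.1 x) * delta F (push p.2 y))).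
apply: eq_bigr => m _; congr (_ *: _); apply: eq_bigr => ab _.
by apply: eq_bigr => theta _; rewrite deltaM pushM !push_lcomp.
Qed.

(** Conjugating [push phi x] by $z^{-1}$ replaces [phi] by its composite with [z], so this is an
    instance of the averaging over orbits. *)
Lemma orbsum_push k n (phi : linj gT k n) x :
  #|{: linj gT k n}|%:R *: orbsum F (push phi x)
  = #|{: wreath gT n}|%:R *: linj_sum x n.
Proof.
rewrite -(sum_linj_orbit _ phi); congr (_ *: _).
rewrite /orbsum (reindex_inj invg_inj) /=; apply: eq_bigr => z _.
by rewrite push_lcomp push_linj_of.
Qed.

Lemma linj_sum_full m (x : wreath gT m) : linj_sum x m = orbsum F x.
Proof.
have := orbsum_push (linj_of 1%g) x.
rewrite push_linj_of invg1 conjg1 card_linj ffactnn mulnC -card_wreath.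
by move/(scalerI (natr_group_neq0 _ _)).
Qed.

Lemma linj_sum_small k (x : wreath gT k) n : (n < k)%N -> linj_sum x n = 0.
Proof.
move=> ltnk; rewrite /linj_sum big1 // => phi _.
have := leq_card _ (@pos_inj _ _ _ phi); rewrite !card_ord.
by rewrite leqNgt ltnk.
Qed.

(** The tensor product of two orbit sums is the orbit sum of the pair in the product group, and
    induction along [embed] sends orbit sums to orbit sums. *)
Lemma creation_orbsum r m gamma (a : wreath gT r) (b : wreath gT m) (c c' : F) :
  sigma_ r gamma = c *: orbsumC F a ->
  creation r gamma (inDegree (c' *: orbsumC F b))
  = inDegree ((c * c') *: orbsumC F (embed (a, b))).
Proof.
move=> sE; transitivity (inDegree (Ind (@embed gT r m)
  [ffun h => (c *: orbsumC F a) h.1 * (c' *: orbsumC F b) h.2])).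
  by rewrite -sE.
congr (inDegree _).
rewrite -(ind_orbsum _ _ (@embed_inj _ r m) (@embedM _ r m)).
apply: classAlgP => x; rewrite classfunZ groupAlgZE /= !ffunE mulrCA; congr (_ * _).
rewrite mulr_sumr; apply: eq_bigr => y _; rewrite mulr_sumr.
apply: eq_bigr => -[h1 h2] _; rewrite !ffunE /= !orbsumE.
rewrite mulrACA; congr (_ * _).
rewrite big_distrlr /= pair_bigA /=; apply: eq_bigr => -[z1 z2] _ /=.
by rewrite -natrM mulnb.
Qed.
End LinjVectors.

(** * Cycles, cycle-products and cycle types in Gamma_n *)

Section Cycles.
Variable gT : finGroupType.
Local Open Scope nat_scope.
Local Open Scope group_scope.
Implicit Types (k l m n r : nat) (c : conjClass gT).

Lemma conjClassJ c x y : (x ^ y \in val c) = (x \in val c).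
Proof.
have /imsetP[z _ ->] := valP c.
by rewrite memJ_norm // (subsetP (class_norm z [set: gT]%G)) ?inE.
Qed.

Lemma conjClass_conj c x y : x \in val c -> y \in val c -> exists z, y = x ^ z.
Proof.
have /imsetP[w _ ->] := valP c => /imsetP[z _ ->] /imsetP[z' _ ->].
by exists (z^-1 * z'); rewrite -conjgM mulKVg.
Qed.

Definition class_of x : conjClass gT :=
  exist (fun c : {set gT} => c \in classes [set: gT]) (x ^: [set: gT])
        (mem_classes (in_setT x)).

Lemma mem_class_of x : x \in val (class_of x).
Proof. exact: class_refl. Qed.

Lemma mem_conjClass x c : (x \in val c) = (c == class_of x).
Proof.
apply/idP/eqP => [|->]; last exact: mem_class_of.
case: c => C Cc /= xC; apply: val_inj => /=.
by have /imsetP[z _ Cz] := Cc; rewrite Cz; apply/esym/class_eqP; rewrite -Cz.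
Qed.

Definition cyclen n (x : wreath gT n) i := #|porbit x.2 i|.
(** The power returns [i] to itself, so this is the label gathered once around the cycle through
    [i]: its cycle-product, up to conjugacy. *)
Definition cyclab n (x : wreath gT n) i := steplab (x ^+ cyclen x i) i.

Lemma wreathX2 n (x : wreath gT n) s i : (x ^+ s).2 i = (x.2 ^+ s) i.
Proof. by rewrite expg_wreath2. Qed.

Lemma cyclen_gt0 n (x : wreath gT n) i : 0 < cyclen x i.
Proof. by rewrite lt0n card_porbit_neq0. Qed.

Lemma cyclenE n (x : wreath gT n) i : (x ^+ cyclen x i).2 i = i.
Proof. by rewrite wreathX2 permX iter_porbit. Qed.

Lemma cyclen_inj n (x : wreath gT n) i s t : s < cyclen x i -> t < cyclen x i ->
  (x ^+ s).2 i = (x ^+ t).2 i -> s = t.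
Proof.
rewrite !wreathX2 !permX => lts ltt e; apply/eqP.
rewrite -(nth_uniq i _ _ (uniq_traject_porbit x.2 i)) ?size_traject //.
by rewrite !nth_traject // e.
Qed.

Lemma intertwines_cyclen k n (phi : linj gT k n) a u j : intertwines phi a u ->
  cyclen u (pos phi j) = cyclen a j.
Proof.
move=> Iau; rewrite /cyclen -(card_imset _ (@pos_inj _ _ _ phi)).
apply: eq_card => i; apply/porbitP/imsetP => [[s ->] | [j' /porbitP[s ->] ->]].
  exists ((a.2 ^+ s) j); first exact: mem_porbit.
  by rewrite -!wreathX2 (intertwinesX s Iau j).1.
by exists s; rewrite -!wreathX2 (intertwinesX s Iau j).1.
Qed.

Lemma intertwines_cyclab k n (phi : linj gT k n) a u j : intertwines phi a u ->
  cyclab u (pos phi j) = cyclab a j ^ (lab phi j)^-1.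
Proof.
move=> Iau; rewrite /cyclab (intertwines_cyclen j Iau).
have [_ e] := intertwinesX (cyclen a j) Iau j.
by apply: (mulIg (lab phi j)); rewrite e cyclenE conjgE invgK -!mulgA mulVg mulg1.
Qed.

(** Points are counted rather than cycles, which avoids choosing representatives: each [r]-cycle
    with cycle-product in [c] contributes [r]. *)
Definition ncyc n (x : wreath gT n) r c : nat :=
  \sum_i ((cyclen x i == r) && (cyclab x i \in val c)).

Lemma ncycJ n (x z : wreath gT n) r c : ncyc (x ^ z) r c = ncyc x r c.
Proof.
have Ix := intertwines_linj_of z^-1 x.
rewrite invgK -mulgA -conjgE in Ix.
rewrite /ncyc (reindex_inj (@pos_inj _ _ _ (linj_of z^-1))) /=.
apply: eq_bigr => j _.
by rewrite (intertwines_cyclen j Ix) (intertwines_cyclab j Ix) conjClassJ.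
Qed.

Definition linj_l k m : linj gT k (k + m) := mklinj (@lshift_inj k m) (fun=> 1).
Definition linj_r k m : linj gT m (k + m) := mklinj (@rshift_inj k m) (fun=> 1).

Lemma embed_l k m (a : wreath gT k) (b : wreath gT m) :
  intertwines (linj_l k m) a (embed (a, b)).
Proof.
move=> j; rewrite !pos_mk !lab_mk /steplab /= embed_perml ffunE split_lshift.
by rewrite mulg1 mul1g.
Qed.

Lemma embed_r k m (a : wreath gT k) (b : wreath gT m) :
  intertwines (linj_r k m) b (embed (a, b)).
Proof.
move=> j; rewrite !pos_mk !lab_mk /steplab /= embed_permr ffunE split_rshift.
by rewrite mulg1 mul1g.
Qed.

(** The left block consists of fixed points with trivial step labels. This is how creation by the
    class function 1 becomes a push-forward. *)
Lemma embed1_push k m (b : wreath gT m) : embed (1 : wreath gT k, b) = push (linj_r k m) b.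
Proof.
apply/esym/push_uniq; first exact: embed_r.
move=> i /notin_posP ni; case: (split_ordP i) => j ij.
  have [e1 e2] := embed_l (1 : wreath gT k) b j; move: e1 e2.
  by rewrite !pos_mk !lab_mk wreath1_2 steplab1 !mulg1 -ij => -> ->.
by have := ni j; rewrite pos_mk ij eqxx.
Qed.

Lemma ncyc_embed k m (a : wreath gT k) (b : wreath gT m) r c :
  ncyc (embed (a, b)) r c = (ncyc a r c + ncyc b r c)%N.
Proof.
rewrite /ncyc big_split_ord /=; congr (_ + _)%N; apply: eq_bigr => j _.
  have -> : lshift m j = pos (linj_l k m) j by rewrite pos_mk.
  rewrite (intertwines_cyclen j (embed_l a b)).
  by rewrite (intertwines_cyclab j (embed_l a b)) conjClassJ.
have -> : rshift k j = pos (linj_r k m) j by rewrite pos_mk.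
rewrite (intertwines_cyclen j (embed_r a b)).
by rewrite (intertwines_cyclab j (embed_r a b)) conjClassJ.
Qed.

Lemma intertwines_conj n (phi : linj gT n n) a u :
  intertwines phi a u -> exists z, u = a ^ z.
Proof.
move=> Iu; have [z zphi] := linj_trans (linj_of 1) phi.
rewrite -linj_ofM mulg1 in zphi; exists z^-1.
rewrite -push_linj_of zphi; apply/esym/push_uniq => // i /notin_posP ni.
have := ni (z^-1.2 i); rewrite -zphi pos_mk -wreathM2 mulgV wreath1_2.
by rewrite eqxx.
Qed.

Section FullCycle.
Variables (r : nat) (a : wreath gT r) (j0 : 'I_r).
Hypothesis full : porbit a.2 j0 = [set: 'I_r].

Lemma cyclen_full j : cyclen a j = r.
Proof.
have /eqP e : porbit a.2 j == porbit a.2 j0 by rewrite eq_porbit_mem full inE.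
by rewrite /cyclen e full cardsT card_ord.
Qed.

Lemma expg_full2 j : (a ^+ r).2 j = j.
Proof. by have := cyclenE a j; rewrite cyclen_full. Qed.

Lemma cyclab_full j : cyclab a j = steplab (a ^+ r) j.
Proof. by rewrite /cyclab cyclen_full. Qed.

(** The map is built along the cycle from the single value $\phi(j_0, 1) = (i, g)$; conjugacy of the
    two cycle-products makes it close up after [r] steps. *)
Lemma cycle_intertwines n (u : wreath gT n) i g :
  cyclen u i = r -> cyclab u i = cyclab a j0 ^ g^-1 ->
  exists phi : linj gT r n, intertwines phi a u.
Proof.
move=> lenu labu.
have ex j : exists s : 'I_r, j == (a ^+ s).2 j0.
  have : j \in porbit a.2 j0 by rewrite full inE.
  rewrite porbit_traject -[#|_|]/(cyclen a j0) cyclen_full => /trajectP[s lts ->].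
  by exists (Ordinal lts); rewrite wreathX2 permX.
(* The number of steps of [a] leading from [j0] to [j]. *)
pose s j := xchoose (ex j).
have sP j : (a ^+ s j).2 j0 = j by rewrite -(eqP (xchooseP (ex j))).
have s_uniq j (t : 'I_r) : (a ^+ t).2 j0 = j -> s j = t.
  move=> e; apply/val_inj/(@cyclen_inj _ a j0); rewrite ?cyclen_full ?sP ?ltn_ord //.
(* Positions and labels are forced by intertwining the powers $a^s$ and $u^s$ at the base point. *)
pose f j := (u ^+ s j).2 i.
pose h j := steplab (u ^+ s j) i * g * (steplab (a ^+ s j) j0)^-1.
have injf : injective f.
  move=> j1 j2 e; rewrite -[j1]sP -[j2]sP.
  by rewrite (@cyclen_inj _ u i (s j1) (s j2)) ?lenu.
have step j : (u ^+ (s j).+1).2 i = f (a.2 j)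
  /\ steplab (u ^+ (s j).+1) i * g * (steplab (a ^+ (s j).+1) j0)^-1 = h (a.2 j).
  have aj : a.2 j = (a ^+ (s j).+1).2 j0 by rewrite expgS wreathM2 sP.
  have [lt | ge] := ltnP (s j).+1 r.
    by rewrite /f /h (s_uniq (a.2 j) (Ordinal lt)).
  (* On the closing step the count wraps around to 0, and the hypothesis on the cycle-products
     enters. *)
  have e : (s j).+1 = r by apply/eqP; rewrite eqn_leq ge ltn_ord.
  have r_gt0 : 0 < r by rewrite -e.
  have aj0 : a.2 j = j0 by rewrite aj e expg_full2.
  have u2 : (u ^+ r).2 i = i by rewrite -lenu cyclenE.
  have ul : steplab (u ^+ r) i = cyclab u i by rewrite /cyclab lenu.
  have s0 : s j0 = Ordinal r_gt0 by apply: s_uniq; rewrite wreath1_2.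
  have x0 k (x : wreath gT k) : x ^+ Ordinal r_gt0 = 1 by [].
  rewrite /f /h aj0 s0 !x0 wreath1_2 !steplab1 e u2 ul.
  rewrite -cyclab_full; split=> //.
  rewrite labu conjgE invgK mul1g invg1 mulg1.
  by rewrite -!mulgA mulKg mulgV mulg1.
exists (mklinj injf h) => j; rewrite !pos_mk !lab_mk.
have [<- <-] := step j; split; first by rewrite -wreathM2 -expgS.
rewrite !expgS !steplabM sP invMg /h /f !mulgA.
by rewrite mulgKV.
Qed.

Lemma embed_restrict m (v : wreath gT (r + m)) :
  intertwines (linj_l r m) a v -> exists b, v = embed (a, b).
Proof.
move=> Iv; have vl j : v.2 (lshift m j) = lshift m (a.2 j).
  by have [] := Iv j; rewrite !pos_mk.
have vl1 j : steplab v (lshift m j) = steplab a j.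
  by have [] := Iv j; rewrite !pos_mk !lab_mk mulg1 mul1g.
have vr (y : 'I_m) : exists y', v.2 (rshift r y) == rshift r y'.
  case: (split_ordP (v.2 (rshift r y))) => j e; last by exists j; rewrite e.
  have : v.2 (rshift r y) = v.2 (lshift m (a.2^-1 j)) by rewrite vl permKV.
  by move/perm_inj/eqP; rewrite eq_rlshift.
pose f y := xchoose (vr y).
have fP y : v.2 (rshift r y) = rshift r (f y) by apply/eqP/(xchooseP (vr y)).
have injf : injective f.
  move=> y y' e; apply: (@rshift_inj r m); apply: (@perm_inj _ v.2).
  by rewrite !fP e.
exists (mkwreath (perm injf) (fun y => steplab v (rshift r y))).
set b := mkwreath _ _; apply: wreathP => i; case: (split_ordP i) => j ->.
- by rewrite vl embed_perml.
- by rewrite fP embed_permr permE.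
- have [_] := embed_l a b j; rewrite !pos_mk !lab_mk mulg1 mul1g => ->.
  by rewrite vl1.
have [_] := embed_r a b j; rewrite !pos_mk !lab_mk mulg1 mul1g => ->.
by rewrite steplab_mkwreath.
Qed.

(** By transitivity the cycle through [i] can be conjugated onto the left block. This peels off one
    cycle in the inductions on cycle type. *)
Lemma split_cycle m (u : wreath gT (r + m)) i g :
  cyclen u i = r -> cyclab u i = cyclab a j0 ^ g ->
  exists b z, u ^ z = embed (a, b).
Proof.
move=> lenu labu; have [|phi Iphi] := @cycle_intertwines _ u i g^-1 lenu.
  by rewrite invgK.
have [z zphi] := linj_trans phi (linj_l r m).
have [|b bE] := @embed_restrict m (u ^ z^-1); last by exists b, z^-1.
rewrite -zphi; apply: (intertwines_lcomp Iphi).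
by rewrite conjgE invgK mulgA; apply: intertwines_linj_of.
Qed.

Lemma ncyc_full r' c :
  ncyc a r' c = (r * ((r == r') && (cyclab a j0 \in val c)))%N.
Proof.
have labE j : (cyclab a j \in val c) = (cyclab a j0 \in val c).
  have : j \in porbit a.2 j0 by rewrite full inE.
  case/porbitP=> s ->; elim: s => [|s IHs]; first by rewrite perm1.
  rewrite -IHs expgSr permM; set i := (a.2 ^+ s) j0.
  (* As [a] commutes with itself, it acts as a labelled injection that moves the base point one step
     along the cycle. *)
  have Ia : intertwines (linj_of a) a a.
    by have := intertwines_linj_of a a; rewrite mulgK.
  by have := intertwines_cyclab i Ia; rewrite pos_mk => ->; rewrite conjClassJ.
rewrite /ncyc (eq_bigr (fun=> ((r == r') && (cyclab a j0 \in val c) : nat))).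
  by rewrite sum_nat_const card_ord.
by move=> j _; rewrite cyclen_full labE.
Qed.

End FullCycle.

Lemma full_cycle_conj r (a b : wreath gT r) i j c :
  porbit a.2 i = [set: 'I_r] -> porbit b.2 j = [set: 'I_r] ->
  cyclab a i \in val c -> cyclab b j \in val c -> exists z, b = a ^ z.
Proof.
move=> fa fb ca cb; have [g gE] := conjClass_conj ca cb.
have [|//|phi /intertwines_conj//] := @cycle_intertwines r a i fa r b j g^-1.
  by apply: cyclen_full fb _.
by rewrite invgK.
Qed.

(** The two readings of the label around the cycle start one step apart; since [x] commutes with
    $x^r$, they are conjugate. *)
Lemma cycle_product_cyclab r (x : wreath gT r) i c :
  porbit x.2 i = [set: 'I_r] ->
  (cycle_product x r i \in val c) = (cyclab x i \in val c).
Proof.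
move=> fx; rewrite cycle_productE /cyclab (cyclen_full fx) /steplab.
have -> : iter r x.2 i = i by rewrite -permX (full_porbitE fx) perm1.
rewrite expg_wreath2 (full_porbitE fx) perm1.
have x2 : (x ^+ r).2 = 1 by rewrite expg_wreath2 (full_porbitE fx).
have e : (x ^+ r) ^ x = x ^+ r.
  by apply/conjg_fixP/commgP/commute_sym/commuteX.
rewrite -{1}e conjg_wreath1 // conjClassJ.
by rewrite permKV.
Qed.

Lemma full_cycle_exists r g :
  exists a : wreath gT r.+1, porbit a.2 ord0 = [set: 'I_r.+1] /\ cyclab a ord0 = g.
Proof.
(* The label [g] sits only on the closing step from the last point to 0, so one turn from 0 gathers
   exactly [g]. *)
pose a : wreath gT r.+1 :=
  mkwreath (perm (@ordS_inj r.+1)) (fun i => if i == ord_max then g else 1).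
have a2 i : a.2 i = ordS i by rewrite permE.
have aE s : s <= r -> (a ^+ s).2 ord0 = s :> nat /\ steplab (a ^+ s) ord0 = 1.
  elim: s => [|s IHs] lts; first by rewrite wreath1_2 steplab1.
  have [e1 e2] := IHs (ltnW lts); rewrite expgS wreathM2 steplabM e2 mulg1.
  move: e1; set i := (a ^+ s).2 ord0 => e1.
  rewrite steplab_mkwreath a2; case: i e1 => i lti /= e1; subst i.
  by rewrite modn_small // -val_eqE /= ltn_eqF.
have fa : porbit a.2 ord0 = [set: 'I_r.+1].
  apply/setP=> j; rewrite inE; apply/porbitP; exists j.
  have [e _] := aE j (leq_ord j).
  by apply: val_inj; rewrite -wreathX2; apply: esym e.
exists a; split=> //; rewrite /cyclab (cyclen_full fa) expgS steplabM.
have [e1 e2] := aE r (leqnn r); rewrite e2 mulg1 steplab_mkwreath.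
have -> : (a ^+ r).2 ord0 = ord_max by apply: val_inj.
by rewrite eqxx.
Qed.

(** The factor [r] reflects that [ncyc] counts points. Entries of length 0 are invisible here, hence
    the separate condition [pos_lengths]. *)
Definition has_cycle_type (w : seq (nat * conjClass gT)) n (u : wreath gT n) :=
  forall r c, ncyc u r c = (r * count_mem (r, c) w)%N.

Definition pos_lengths (w : seq (nat * conjClass gT)) :=
  all (fun rc => 0 < rc.1) w.

Lemma embed_cycle_type r m (a : wreath gT r) (b : wreath gT m) i c w :
  porbit a.2 i = [set: 'I_r] -> cyclab a i \in val c ->
  has_cycle_type ((r, c) :: w) (embed (a, b)) <-> has_cycle_type w b.
Proof.
move=> fa ca.
have e r' c' : ncyc (embed (a, b)) r' c'
    = (r' * ((r, c) == (r', c')) + ncyc b r' c')%N.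
  rewrite ncyc_embed (ncyc_full fa) mem_conjClass xpair_eqE; congr (_ + _)%N.
  rewrite mem_conjClass in ca; rewrite -(eqP ca) [c' == c]eq_sym.
  by case: eqP => [->|]; rewrite ?muln0.
split=> tb r' c'; last by rewrite e tb /= mulnDr.
by apply/eqP; rewrite -(eqn_add2l (r' * ((r, c) == (r', c')))) -e tb mulnDr.
Qed.

Lemma cycle_typeJ w n (u z : wreath gT n) :
  has_cycle_type w (u ^ z) <-> has_cycle_type w u.
Proof. by split=> tu r c; have := tu r c; rewrite ncycJ. Qed.

(* Eliminating into a predicate Q avoids transporting u along r + m = n. *)
Lemma cycle_ind (Q : forall n, wreath gT n -> Prop) n (u : wreath gT n) i c :
  (forall n' (v z : wreath gT n'), Q n' (v ^ z) -> Q n' v) ->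
  (forall r m (a : wreath gT r) (b : wreath gT m) j,
     r = cyclen u i -> (r + m)%N = n ->
     porbit a.2 j = [set: 'I_r] -> cyclab a j \in val c -> Q _ (embed (a, b))) ->
  cyclab u i \in val c -> Q n u.
Proof.
move=> QJ Qe ui; have : 0 < cyclen u i by apply: cyclen_gt0.
have : cyclen u i <= n by rewrite /cyclen -[n in _ <= n]card_ord max_card.
move er : (cyclen u i) => r ler; case: r er ler => // r er ler _.
have [a [fa ca]] := full_cycle_exists r (cyclab u i).
have e := subnKC ler; move: (n - r.+1)%N e => m e.
case: n / e u i ui er ler ca Qe => u i ui er ler ca Qe.
have [|b [z zb]] := @split_cycle r.+1 a ord0 fa m u i 1 er.
  by rewrite conjg1 ca.
by apply: (QJ _ _ z); rewrite zb; apply: (Qe _ _ _ _ ord0); rewrite ?ca.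
Qed.

(** Strong induction on the degree, removing the cycle through the first point. *)
Lemma cycle_type_exists n (u : wreath gT n) :
  exists2 w, pos_lengths w & has_cycle_type w u.
Proof.
have [k] := ubnP n; elim: k => // k IHk in n u *; rewrite ltnS => lenk.
case: n u lenk => [|n] u lenk.
  by exists [::] => // r c; rewrite /ncyc big_ord0 muln0.
pose Q n' (v : wreath gT n') := exists2 w, pos_lengths w & has_cycle_type w v.
apply: (@cycle_ind Q _ u ord0 (class_of (cyclab u ord0))).
- by move=> n' v z [w w0 wv]; exists w => //; apply/(cycle_typeJ _ _ z).
- move=> r m a b j er ern fa ca; have r_gt0 := cyclen_gt0 u ord0.
  have [|w w_gt0 wb] := IHk m b.
    apply: leq_trans lenk; rewrite -ern -[X in X <= _]add1n leq_add2r.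
    by rewrite er.
  exists ((r, class_of (cyclab u ord0)) :: w).
    by rewrite /pos_lengths /= er r_gt0.
  exact/(embed_cycle_type _ _ fa).
exact: mem_class_of.
Qed.

Lemma wreath_of_type w : pos_lengths w ->
  exists n (u : wreath gT n), has_cycle_type w u.
Proof.
elim: w => [_|[[|r] c] w IHw] //=.
  by exists 0%N, 1 => r c; rewrite /ncyc big_ord0 muln0.
move=> /IHw[m [b wb]]; have /imsetP[g _ cE] := valP c.
have [a [fa ga]] := full_cycle_exists r g.
exists (r.+1 + m)%N, (embed (a, b)).
apply/(embed_cycle_type _ _ fa) => //.
by rewrite ga cE class_refl.
Qed.

End Cycles.

(** * Iterated composition as a fold, and partitions through their multiplicities *)

Lemma big_compE (I : Type) (T : Type) (s : seq I) (f : I -> T -> T) x :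
  (\big[comp/id]_(i <- s) f i) x = foldr f x s.
Proof. by elim: s => [|i s IHs]; rewrite ?big_nil ?big_cons //= IHs. Qed.

Lemma foldr_flatten (I T : Type) (f : I -> T -> T) x ss :
  foldr f x (flatten ss) = foldr (fun s y => foldr f y s) x ss.
Proof. by elim: ss => //= s ss IHss; rewrite foldr_cat IHss. Qed.

Lemma eq_foldr (I T : Type) (f g : I -> T -> T) x s :
  (forall i, f i =1 g i) -> foldr f x s = foldr g x s.
Proof. by move=> fg; elim: s => //= i s ->; rewrite fg. Qed.

Lemma foldr_nseq (I T : Type) (f : I -> T -> T) x n i :
  foldr f x (nseq n i) = iter n (f i) x.
Proof. by elim: n => //= n ->. Qed.

Lemma sumn_mult (s : seq nat) B : all (fun r => 0 < r < B)%N s ->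
  (\sum_(1 <= r < B) count_mem r s * r)%N = sumn s.
Proof.
elim: s => [_|a s IHs] /=; first by rewrite big1.
case/andP=> aB /IHs <-; under eq_bigr => r _ do rewrite mulnDl.
rewrite big_split /=; congr (_ + _)%N.
rewrite (bigD1_seq a) /= ?mem_index_iota ?iota_uniq // eqxx mul1n big1 ?addn0 //.
by move=> r ra; rewrite eq_sym (negPf ra).
Qed.

Lemma intpart_pos (lambda : intpart) r : r \in (lambda : seq nat) -> (0 < r)%N.
Proof. by case: lambda => s /= /andP[_ s0] rs; rewrite lt0n; apply: contraNneq s0 => <-. Qed.

Lemma mult0 lambda : mult 0 lambda = 0%N.
Proof.
apply/count_memPn/negP => /intpart_pos.
by rewrite ltnn.
Qed.

Lemma intpart_multP (lambda mu : intpart) :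
  (forall r, (0 < r)%N -> mult r lambda = mult r mu) -> lambda = mu.
Proof.
move=> e; apply: val_inj; apply: (@sorted_eq _ geq).
- by move=> x y z /= xy yz; apply: leq_trans yz xy.
- by move=> x y; rewrite /= -eqn_leq eq_sym => /eqP.
- by case: lambda {e} => s /= /andP[].
- by case: mu {e} => s /= /andP[].
apply/allP=> r _ /=; apply/eqP; case: (posnP r) => [->|/e //].
exact: etrans (mult0 lambda) (esym (mult0 mu)).
Qed.

Lemma mem_leq_sumn (s : seq nat) r : r \in s -> (r <= sumn s)%N.
Proof.
elim: s => //= a s IHs; rewrite inE => /orP[/eqP-> | /IHs le].
  exact: leq_addr.
exact: leq_trans le (leq_addl _ _).
Qed.

(** * Families of partitions as cycle types *)

Section FamilyTypes.
Variable gT : finGroupType.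
Implicit Types (n : nat) (rho sigma : partFamily gT).

Lemma mem_family_leq rho c r : r \in (rho c : seq nat) -> (r <= famsize rho)%N.
Proof.
move/mem_leq_sumn => le; rewrite /famsize (bigD1 c) //=.
exact: leq_trans le (leq_addr _ _).
Qed.

(** The word spells out the product of creation operators in [part_vector], one letter [(r, c)] per
    factor and in the same order. *)
Definition family_word rho : seq (nat * conjClass gT) :=
  flatten [seq flatten [seq nseq (mult r (rho c)) (r, c)
                       | r <- index_iota 1 (famsize rho).+1]
          | c <- index_enum (conjClass gT)].

Lemma family_word_pos rho : pos_lengths (family_word rho).
Proof.
apply/allP=> -[r c] /flatten_mapP[c' _ /flatten_mapP[r' r'P]].
by rewrite mem_nseq => /andP[_ /eqP[-> _]]; rewrite mem_index_iota in r'P; case/andP: r'P.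
Qed.

Lemma count_family_word rho r c :
  count_mem (r, c) (family_word rho) = mult r (rho c).
Proof.
rewrite count_flatten sumnE !big_map (bigD1 c) //= [X in (_ + X)%N]big1 => [|c' nc].
  rewrite addn0 count_flatten sumnE !big_map.
  under eq_bigr => r' _ do rewrite count_nseq /= xpair_eqE eqxx andbT.
  have [rin | rout] := boolP (r \in index_iota 1 (famsize rho).+1).
    rewrite (bigD1_seq r) ?iota_uniq //= eqxx mul1n big1 ?addn0 // => r' nr.
    by rewrite (negPf nr).
  rewrite big1_seq => [|r' /= r'in]; last first.
    by case: eqP rout => // <-; rewrite r'in.
  apply/esym/count_memPn; apply: contra rout => rr.
  by rewrite mem_index_iota (intpart_pos rr) ltnS (mem_family_leq rr).
rewrite count_flatten sumnE !big_map big1 // => r' _.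
by rewrite count_nseq /= xpair_eqE (negPf nc) andbF.
Qed.

Lemma sum_family_word rho :
  (\sum_(rc <- family_word rho) rc.1)%N = famsize rho.
Proof.
rewrite big_flatten big_map; apply: eq_bigr => c _.
rewrite big_flatten big_map /= -(@sumn_mult _ (famsize rho).+1); last first.
  apply/allP=> r rin; rewrite (intpart_pos rin) ltnS.
  exact: mem_family_leq rin.
by apply: eq_bigr => r _; rewrite big_nseq iter_addn_0 mulnC.
Qed.

Definition has_family_type rho n (u : wreath gT n) :=
  has_cycle_type (family_word rho) u.

Lemma has_family_typeP rho n (u : wreath gT n) : has_family_type rho u <->
  forall r c, ncyc u r c = (r * mult r (rho c))%N.
Proof. by split=> ru r c; rewrite ru count_family_word. Qed.

Lemma family_type_inj rho sigma n (u : wreath gT n) :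
  has_family_type rho u -> has_family_type sigma u -> rho = sigma.
Proof.
move=> /has_family_typeP ru /has_family_typeP su; apply/ffunP=> c.
apply: intpart_multP => r r_gt0; apply/eqP; rewrite -(eqn_pmul2l r_gt0).
by rewrite -ru su.
Qed.

Lemma family_of_word (w : seq (nat * conjClass gT)) : pos_lengths w ->
  exists rho, forall r c, mult r (rho c) = count_mem (r, c) w.
Proof.
move=> w_gt0; pose s c := sort geq [seq rc.1 | rc <- w & rc.2 == c].
have sP c : sorted geq (s c) && (0%N \notin s c).
  apply/andP; split; first by apply: sort_sorted => x y; apply: leq_total.
  rewrite mem_sort; apply/mapP=> -[[r c']].
  rewrite mem_filter => /andP[_ /(allP w_gt0) /= r_gt0] r0.
  by rewrite -r0 in r_gt0.
exists [ffun c => IntPart (sP c)] => r c; rewrite /mult ffunE /=.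
have /seq.permP -> : perm_eq (s c) [seq rc.1 | rc <- w & rc.2 == c].
  by rewrite perm_sort.
rewrite count_map count_filter; apply: eq_count => -[r' c'] /=.
by rewrite xpair_eqE.
Qed.

Lemma family_type_exists n (u : wreath gT n) : exists rho, has_family_type rho u.
Proof.
have [w w_gt0 wu] := cycle_type_exists u.
have [rho rhoE] := family_of_word w_gt0.
by exists rho; apply/has_family_typeP => r c; rewrite rhoE.
Qed.

Lemma wreath_of_family rho : exists n (u : wreath gT n), has_family_type rho u.
Proof. exact: wreath_of_type (family_word_pos rho). Qed.

End FamilyTypes.

(** * Identification of p_rho(n) with a multiple of P_u(n) *)

Section Creation.
Variables (F : numFieldType) (gT : finGroupType).
Implicit Types (k l m n r : nat) (c : conjClass gT) (rho : partFamily gT).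

Lemma orbsum_self_neq0 (G : finGroupType) (x : G) : orbsum F x x != 0.
Proof.
rewrite orbsumE -natr_sum pnatr_eq0 (bigD1 1%g) //= conjg1 eqxx.
by [].
Qed.

Lemma sigma_full r (x : wreath gT r) i c : porbit x.2 i = [set: 'I_r] ->
  sigma_ r (K_ F c) x = r%:R * (cyclab x i \in val c)%:R.
Proof.
move=> fx; rewrite ffunE /sigma_val.
case: pickP => [j /eqP fj | /(_ i)]; last by rewrite fx eqxx.
rewrite -(cycle_product_cyclab _ fx); congr (_ * _).
have := cycle_product_full (K_ F c) 1%g j fx; rewrite conjg1 => <-.
by rewrite ffunE.
Qed.

(** The full cycles with cycle-product in [c] form one conjugacy class; $\sigma_r(K^c)$ has the
    constant value [r] on it and vanishes elsewhere. *)
Lemma sigma_orbsum r (a : wreath gT r) i c :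
  porbit a.2 i = [set: 'I_r] -> cyclab a i \in val c ->
  exists2 kappa : F, kappa != 0 & sigma_ r (K_ F c) = kappa *: orbsumC F a.
Proof.
move=> fa ca; have r_neq0 : r%:R != 0 :> F.
  by rewrite pnatr_eq0 -lt0n (leq_ltn_trans _ (ltn_ord i)).
(* The ratio of the two values at [a], that is, [r] over the order of the centralizer of [a]. *)
exists (r%:R / orbsum F a a).
  by rewrite mulf_neq0 ?invr_neq0 ?orbsum_self_neq0.
apply: classAlgP => y; rewrite classfunZ groupAlgZE /=.
have sJ z : sigma_ r (K_ F c) (a ^ z)%g = r%:R.
  by have /is_classfunP -> := valP (sigma_ r (K_ F c)); rewrite (sigma_full _ fa) ca mulr1.
have oJ z : orbsum F a (a ^ z)%g = orbsum F a a.
  by have /is_classfunP -> := orbsum_class F a.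
have [/existsP[z /eqP ->] | noz] := boolP [exists z, y == (a ^ z)%g].
  by rewrite sJ oJ mulfVK ?orbsum_self_neq0.
have -> : orbsum F a y = 0.
  rewrite orbsumE big1 // => z _.
  by rewrite (negPf (existsPn noz z)).
rewrite mulr0; have [/existsP[j /eqP fy] | nofy] := boolP [exists j, porbit y.2 j == [set: 'I_r]].
  rewrite (sigma_full _ fy); case: (boolP (_ \in _)) => [cy | _]; last by rewrite mulr0.
  have [z yz] := full_cycle_conj fa fy ca cy.
  by case/existsP: noz; exists z; rewrite yz.
rewrite ffunE /sigma_val; case: pickP => // j fy.
by case/existsP: nofy; exists j.
Qed.

Definition creation_seq (w : seq (nat * conjClass gT)) : homog F gT :=
  foldr (fun rc => creation rc.1 (K_ F rc.2)) (vacuum F gT) w.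

Lemma part_vectorE rho : part_vector F rho = creation_seq (family_word rho).
Proof.
rewrite /part_vector /creation_seq /family_word big_compE foldr_flatten.
rewrite foldr_map; apply: eq_foldr => c v.
rewrite big_compE foldr_flatten foldr_map.
by apply: eq_foldr => r v'; rewrite foldr_nseq.
Qed.

Lemma ncyc_gt0P n (u : wreath gT n) r c : (0 < ncyc u r c)%N ->
  exists i, cyclen u i = r /\ cyclab u i \in val c.
Proof.
case: (pickP (fun i => (cyclen u i == r) && (cyclab u i \in val c))) => [i|none].
  by case/andP=> /eqP; exists i.
by rewrite /ncyc big1 // => i _; rewrite none.
Qed.

(** The first letter of the word is matched with a cycle of [u]. Conjugating that cycle to the left
    block brings [u] to the form [embed (a, b)], to which one creation operator applies. *)
Lemma creation_seq_orbsum w n (u : wreath gT n) :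
  pos_lengths w -> has_cycle_type w u ->
  n = (\sum_(rc <- w) rc.1)%N /\
  exists2 kappa : F, kappa != 0 & creation_seq w = inDegree (kappa *: orbsumC F u).
Proof.
elim: w n u => [|[r c] w IHw] n u /=.
  move=> _ u0; rewrite big_nil.
  case: n u u0 => [|n] u u0; last first.
    have := u0 (cyclen u ord0) (class_of (cyclab u ord0)).
    rewrite /ncyc muln0 => /eqP; rewrite sum_nat_eq0 => /forallP/(_ ord0).
    by rewrite eqxx mem_class_of.
  split=> //; exists 1; rewrite ?oner_neq0 // scale1r; congr (inDegree _).
  have all1 (x y : wreath gT 0) : x = y by apply: wreathP => -[].
  apply: classAlgP => x; rewrite orbsumE (bigD1 1%g) //= big1 => [|z].
    by rewrite (all1 (u ^ 1)%g x) eqxx addr0 ffunE (all1 x 1%g) eqxx.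
  by rewrite (all1 z 1%g) eqxx.
case/andP=> r_gt0 w_gt0 tu.
have [i [er ci]] : exists i, cyclen u i = r /\ cyclab u i \in val c.
  by apply: ncyc_gt0P; rewrite tu /= eqxx muln_gt0 r_gt0.
pose Q n (u : wreath gT n) := has_cycle_type ((r, c) :: w) u ->
  n = (\sum_(rc <- (r, c) :: w) rc.1)%N /\
  exists2 kappa : F, kappa != 0 &
    creation_seq ((r, c) :: w) = inDegree (kappa *: orbsumC F u).
apply: (@cycle_ind _ Q n u i c _ _ ci tu).
  move=> n' v z IH tv; have [|en [kappa k0 kE]] := IH.
    exact/cycle_typeJ.
  by split=> //; exists kappa => //; rewrite kE orbsumCJ.
rewrite er => r' m a b j er'; subst r' => _ fa ca /(embed_cycle_type _ _ fa ca) tb.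
have [em [kappa k0 kE]] := IHw m b w_gt0 tb.
have [kappa' k0' kE'] := sigma_orbsum fa ca.
split; first by rewrite big_cons em.
exists (kappa' * kappa); first exact: mulf_neq0.
by rewrite /= kE; apply: creation_orbsum.
Qed.

Lemma sigma1_orbsum :
  sigma_ 1 (1 : classAlg F gT) = #|gT|%:R^-1 *: orbsumC F (1%g : wreath gT 1).
Proof.
apply: classAlgP => x; rewrite classfunZ groupAlgZE /= orbsumE.
under eq_bigr => z _ do rewrite conj1g.
rewrite sumr_const -[X in _ * X]mulr_natl card_wreath expn1 muln1.
rewrite mulKf ?natr_group_neq0 // ffunE /sigma_val.
case: pickP => [i _ | /(_ ord0)]; last first.
  rewrite -{1}[porbit _ _]setIT => /eqP[]; apply/setP=> j.
  by rewrite !inE andbT (ord1 j) -(ord1 (ord0)) porbit_id.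
rewrite mul1r /cycle_product /= rev_cons big_cons big_nil mulg1 ffunE.
congr (nat_of_bool _)%:R; apply/eqP/eqP => [x1 | ->]; last by rewrite ffunE.
apply: wreathP => j; rewrite !(ord1 (_ j)) //.
by rewrite steplab1 /steplab (ord1 (_ j)) -(ord1 i).
Qed.

(** Each $\mathfrak p_{-1}(1)$ adjoins a fixed point with trivial label, hence composes [phi] with
    an inclusion, at the price of a factor 1/|Gamma|. *)
Lemma iter_creation1 j k (u : wreath gT k) (kappa : F) :
  exists phi : linj gT k (j + k),
   iter j (creation 1 1) (inDegree (kappa *: orbsumC F u))
   = inDegree ((#|gT|%:R ^- j * kappa) *: orbsumC F (push phi u)).
Proof.
elim: j => [|j [phi IHj]].
  by exists (linj_of 1%g); rewrite push_linj_of invg1 conjg1 invr1 mul1r.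
exists (lcomp (linj_r gT 1 (j + k)) phi).
rewrite iterS IHj (creation_orbsum _ _ sigma1_orbsum) embed1_push push_lcomp.
by rewrite mulrA -invfM -exprS.
Qed.

Lemma component_inDegree n (v : classAlg F (wreath gT n)) :
  component n (inDegree v) = v.
Proof.
rewrite /component /untag /inDegree /=; case: eqP => // e.
by rewrite (eq_axiomK e).
Qed.

(** For j = n - k, the orbit sum of the push-forward is $j!\,|\Gamma|^j$ times P_u(n). This cancels
    the normalization 1/j! and the factor $|\Gamma|^{-j}$ from the creation operators, so the
    constant does not depend on [n]. *)
Lemma p_linj_sum rho k (u : wreath gT k) : has_family_type rho u ->
  k = famsize rho /\ exists2 kappa : F, kappa != 0 &
    forall n, classfun (p_ F rho n) = kappa *: linj_sum F u n.
Proof.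
move=> tu; have [kE [kappa k0 pE]] := creation_seq_orbsum (family_word_pos rho) tu.
rewrite sum_family_word in kE; split=> //.
exists kappa => // n; rewrite /p_ -kE; case: leqP => [lekn | ltnk]; last first.
  by rewrite linj_sum_small // scaler0.
rewrite part_vectorE pE -(subnK lekn); move: (n - k)%N => j {n lekn}.
rewrite addnK; have [phi ->] := iter_creation1 j u kappa.
rewrite component_inDegree !classfunZ /=.
have g0 : #|gT|%:R != 0 :> F by apply: natr_group_neq0.
have f0 l : l`!%:R != 0 :> F by rewrite pnatr_eq0 -lt0n fact_gt0.
have := orbsum_push F phi u; rewrite card_linj card_wreath.
have /(congr1 (fun m => m%:R : F)) := ffact_fact (leq_addl j k).
rewrite addnK !natrM => factE.
have ff0 : ((j + k) ^_ k)%:R != 0 :> F.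
  by apply: contraNneq (f0 (j + k)%N) => e; rewrite -factE e mul0r.
move/(congr1 (fun v => ((j + k) ^_ k * #|gT| ^ k)%:R^-1 *: v)).
rewrite natrM !scalerA mulVf ?scale1r ?mulf_neq0 // ?natrX ?expf_neq0 // => ->.
rewrite !scalerA -factE; congr (_ *: _).
rewrite exprD; field.
by rewrite f0 ff0 !expf_neq0.
Qed.

End Creation.

(** * Polynomials evaluated at natural numbers *)

Lemma horner_natr_eq0 (F : numFieldType) (q : {poly F}) :
  (forall n, q.[n.+1%:R] = 0) -> q = 0.
Proof.
move=> q0; apply/eqP/contraT => nq0.
have := @max_poly_roots _ q [seq n.+1%:R | n <- iota 0 (size q)] nq0.
rewrite size_map size_iota ltnn => -> //.
  by apply/allP=> _ /mapP[n _ ->]; apply/rootP.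
rewrite map_inj_uniq ?iota_uniq // => m n /eqP.
by rewrite eqr_nat => /eqP[].
Qed.

Definition ffact_poly (F : numFieldType) k : {poly F} :=
  \prod_(i < k) ('X - i%:R%:P).

Lemma horner_ffact_poly (F : numFieldType) k n :
  (ffact_poly F k).[n%:R] = (n ^_ k)%:R.
Proof.
elim: k => [|k IHk]; first by rewrite /ffact_poly big_ord0 hornerC ffactn0.
rewrite /ffact_poly big_ord_recr /= hornerM IHk hornerXsubC ffactnSr natrM.
case: (leqP k n) => [le | lt]; first by rewrite natrB.
by rewrite ffact_small // !mul0r.
Qed.

(** * Combinations of the p_nu(n): structure constants, independence and spanning *)

Section LinearCombinations.
Variables (F : numFieldType) (gT : finGroupType).
Implicit Types (rho sigma nu : partFamily gT) (e : {malg F[partFamily gT]}).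

Lemma lincombEw (V : lmodType F) (b : partFamily gT -> V) (E : {fset partFamily gT}) e :
  (msupp e `<=` E)%fset -> lincomb b e = \sum_(nu <- E) e@_nu *: b nu.
Proof.
move=> sub; rewrite /lincomb (big_fset_incl _ sub) // => nu _ /mcoeff_outdom ->.
by rewrite scale0r.
Qed.

Lemma lincomb_is_linear (V : lmodType F) (b : partFamily gT -> V) :
  linear (lincomb b).
Proof.
move=> a e f; pose E := (msupp e `|` msupp f `|` msupp (a *: e + f))%fset.
rewrite !(@lincombEw V b E) /E.
- rewrite scaler_sumr -big_split /=; apply: eq_bigr => nu _.
  by rewrite mcoeffD mcoeffZ scalerDl scalerA.
- by rewrite -fsetUA fsetUCA fsubsetUl.
- by rewrite -fsetUA fsubsetUl.
exact: fsubsetUr.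
Qed.

HB.instance Definition _ (V : lmodType F) (b : partFamily gT -> V) :=
  GRing.isLinear.Build F {malg F[partFamily gT]} V _ (lincomb b)
    (lincomb_is_linear b).

Lemma lincombD (V : lmodType F) (b : partFamily gT -> V) e f :
  lincomb b (e + f) = lincomb b e + lincomb b f.
Proof. exact: linearD. Qed.

Lemma lincombB (V : lmodType F) (b : partFamily gT -> V) e f :
  lincomb b (e - f) = lincomb b e - lincomb b f.
Proof. exact: linearB. Qed.

Lemma lincombZ (V : lmodType F) (b : partFamily gT -> V) a e :
  lincomb b (a *: e) = a *: lincomb b e.
Proof. exact: linearZ. Qed.

Lemma lincombU (V : lmodType F) (b : partFamily gT -> V) nu :
  lincomb b << nu >> = b nu.
Proof. by rewrite /lincomb msuppU oner_eq0 big_seq_fset1 mcoeffUU scale1r. Qed.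

Lemma lincomb_lin (V W : lmodType F) (f : {linear V -> W}) (b : partFamily gT -> V) e :
  f (lincomb b e) = lincomb (f \o b) e.
Proof. by rewrite linear_sum; apply: eq_bigr => nu _; rewrite linearZ. Qed.

Lemma lincomb_monomials e : lincomb (fun nu => << nu >> : {malg F[partFamily gT]}) e = e.
Proof.
rewrite [RHS]monalgE; apply: eq_bigr => nu _; apply/malgP => mu.
by rewrite mcoeffZ !mcoeffU mulr_natr.
Qed.

(** A single [e] serves all [n], which expresses the independence of [n]; [N] carries the bound on
    the sizes of the families. *)
Definition stably_spanned N (f : forall n, groupAlg F (wreath gT n)) :=
  exists e, (forall nu, nu \in msupp e -> (famsize nu <= N)%N) /\
    forall n, f n = classfun (lincomb ((@p_ F gT)^~ n) e).

Lemma stably_spanned0 N : stably_spanned N (fun=> 0).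
Proof.
exists 0; split=> [nu | n]; first by rewrite msupp0.
by rewrite linear0.
Qed.

Lemma stably_spannedD N f g : stably_spanned N f -> stably_spanned N g ->
  stably_spanned N (fun n => f n + g n).
Proof.
move=> [e [eN fE]] [e' [e'N gE]]; exists (e + e'); split=> [nu|n].
  by move/(fsubsetP (msuppD_le e e')); rewrite inE => /orP[/eN|/e'N].
by rewrite lincombD fE gE.
Qed.

Lemma stably_spannedZ N a f : stably_spanned N f ->
  stably_spanned N (fun n => a *: f n).
Proof.
move=> [e [eN fE]]; exists (a *: e); split=> [nu|n].
  by move/(fsubsetP (msuppZ_le a e))/eN.
by rewrite lincombZ fE.
Qed.

Lemma stably_spanned_sum N (I : Type) (s : seq I) (P : pred I)
    (f : I -> forall n, groupAlg F (wreath gT n)) :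
  (forall i, P i -> stably_spanned N (f i)) ->
  stably_spanned N (fun n => \sum_(i <- s | P i) f i n).
Proof.
move=> fN; elim: s => [|i s [e [eN fE]]].
  have [e [eN fE]] := stably_spanned0 N; exists e; split=> // n.
  by rewrite big_nil.
case Pi: (P i); last by exists e; split=> // n; rewrite big_cons Pi.
have [e' [e'N fE']] := stably_spannedD (fN i Pi) (ex_intro _ e (conj eN fE)).
by exists e'; split=> // n; rewrite big_cons Pi.
Qed.

(** The element [u] has some type [nu], and the nonzero constant relating p_nu(n) to P_u(n) can be
    inverted. *)
Lemma linj_sum_spanned N m (u : wreath gT m) : (m <= N)%N ->
  stably_spanned N (linj_sum F u).
Proof.
have [nu tu] := family_type_exists u.
have [mE [kappa k0 kE]] := p_linj_sum F tu => lemN.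
exists (kappa^-1 *: << nu >>); split=> [mu | n].
  move/(fsubsetP (msuppZ_le _ _)); rewrite msuppU oner_eq0 inE => /eqP->.
  by rewrite -mE.
by rewrite lincombZ lincombU classfunZ kE scalerA mulVf ?scale1r.
Qed.

(** Representatives [x] and [y] of the two types turn the product into a multiple of P_x(n) *
    P_y(n), whose expansion involves only sums P_u(n) with [u] of degree at most [k + l]. *)
Lemma structure_constants_exist :
  exists d : partFamily gT -> partFamily gT -> {malg F[partFamily gT]},
    structure_constants d.
Proof.
pose Q rho sigma e :=
  (forall nu, nu \in msupp e -> (famsize nu <= famsize rho + famsize sigma)%N) /\
  (forall n, p_ F rho n * p_ F sigma n = lincomb ((@p_ F gT)^~ n) e).
have ex (rs : partFamily gT * partFamily gT) : exists e, Q rs.1 rs.2 e.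
  case: rs => rho sigma /=.
  have [k [x tx]] := wreath_of_family rho.
  have [l [y ty]] := wreath_of_family sigma.
  have [kE [a _ aE]] := p_linj_sum F tx.
  have [lE [b _ bE]] := p_linj_sum F ty.
  suff [e [eN fE]] : stably_spanned (famsize rho + famsize sigma)
      (fun n => classfun (p_ F rho n * p_ F sigma n)).
    by exists e; split=> // n; apply: val_inj; apply: fE.
  have [e [eN fE]] : stably_spanned (famsize rho + famsize sigma) (fun n =>
     (a * b) *: \sum_(m < (k + l).+1) #|{: wreath gT m}|%:R^-1 *:
       \sum_(ab : linj gT k m * linj gT l m | jsurj ab)
        linj_sum F (push ab.1 x * push ab.2 y)%g n).
    apply: stably_spannedZ; apply: stably_spanned_sum => m _.
    apply: stably_spannedZ; apply: stably_spanned_sum => ab _.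
    by apply: linj_sum_spanned; rewrite -kE -lE -ltnS.
  exists e; split=> // n; rewrite -fE classfunM aE bE -linj_sumM.
  by rewrite -scalerAl -scalerAr scalerA.
have [d dP] := boolp.choice ex.
by exists (fun rho sigma => d (rho, sigma)); split=> [rho sigma | n rho sigma _];
  have [] := dP (rho, sigma).
Qed.

(** As [push phi x] is the identity only if [x] is, the value is a constant times the number of
    labelled injections, $|\Gamma|^k\,n(n-1)\cdots(n-k+1)$. *)
Lemma p_at1_poly nu : exists q : {poly F},
  forall n, p_ F nu n 1%g = q.[n%:R].
Proof.
have [k [x tx]] := wreath_of_family nu.
have [_ [kappa _ kE]] := p_linj_sum F tx.
exists ((kappa * (1%g == x)%:R * #|gT|%:R ^+ k) *: ffact_poly F k) => n.
rewrite hornerZ horner_ffact_poly kE groupAlgZE sum_groupAlgE -!mulrA.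
congr (_ * _); under eq_bigr => phi _ do rewrite ffunE eq_sym push_inj1 eq_sym.
rewrite sumr_const -[LHS]mulr_natr; congr (_ * _).
by rewrite (_ : #|_| = #|{: linj gT k n}|) // card_linj natrM natrX mulrC.
Qed.

(** Gamma_0 has only the identity, and the value there is polynomial in [n]; vanishing at all
    positive integers forces vanishing at 0. *)
Lemma lincomb_p_at0 e : (forall n, (0 < n)%N -> lincomb ((@p_ F gT)^~ n) e = 0) ->
  lincomb ((@p_ F gT)^~ 0%N) e = 0.
Proof.
move=> e0; have [q qE] : exists q : {poly F},
    forall n, classfun (lincomb ((@p_ F gT)^~ n) e) 1%g = q.[n%:R].
  rewrite /lincomb; elim: (enum_fset (msupp e)) => [|nu s [q qE]].
    by exists 0 => n; rewrite big_nil horner0 ffunE.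
  have [q' q'E] := p_at1_poly nu; exists (e@_nu *: q' + q) => n.
  by rewrite big_cons hornerD hornerZ -qE -q'E ffunE groupAlgZE.
have q0 : q = 0.
  by apply: horner_natr_eq0 => n; rewrite -qE e0 // ffunE.
apply: classAlgP => x; have -> : x = 1%g by apply: wreathP => -[].
by rewrite qE q0 horner0 ffunE.
Qed.

Lemma lincomb_p_eq0 e : (forall n, (0 < n)%N -> lincomb ((@p_ F gT)^~ n) e = 0) ->
  e = 0.
Proof.
(* Degree 0 is recovered first, because the coefficient of the empty family is read off there. *)
move=> e_gt0; have e0 n : lincomb ((@p_ F gT)^~ n) e = 0.
  by case: n => [|n]; [apply: lincomb_p_at0 | apply: e_gt0].
apply/malgP => nu; rewrite mcoeff0.
have [k] := ubnP (famsize nu); elim: k => // k IHk in nu *.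
rewrite ltnS => nuk; have [m [u tu]] := wreath_of_family nu.
have [mE [kappa k0 kE]] := p_linj_sum F tu.
have [nuin | /mcoeff_outdom //] := boolP (nu \in msupp e).
have := congr1 (fun f => classfun f u) (e0 m).
rewrite /lincomb classfun_sum sum_groupAlgE (big_fsetD1 nu nuin) big1_fset.
  rewrite [LHS]addr0 classfunZ kE linj_sum_full !groupAlgZE ffunE => /eqP.
  by rewrite !mulf_eq0 (negPf k0) (negPf (orbsum_self_neq0 _ _)) !orbF => /eqP.
move=> mu; rewrite in_fsetD1 => /andP[neq _] _.
(* Smaller families have coefficient 0 by induction, larger ones vanish in this degree, and a
   different family of equal size lives on another conjugacy class. *)
rewrite classfunZ groupAlgZE; case: (ltngtP (famsize mu) (famsize nu)) => sz.
- by rewrite IHk ?mul0r // (leq_trans sz nuk).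
- by rewrite -mE in sz; rewrite /p_ leqNgt sz /= ffunE mulr0.
have [l [v tv]] := wreath_of_family mu.
have [lE [kappa' _ k'E]] := p_linj_sum F tv.
have elm : l = m by rewrite lE sz -mE.
clear lE; subst l; rewrite k'E linj_sum_full groupAlgZE orbsumE big1 ?mulr0 // => z _.
case: eqP => // uv; case/eqP: neq; apply: (@family_type_inj _ _ _ m u) => //.
by rewrite uv; apply/cycle_typeJ.
Qed.

Lemma structure_constants_uniq
    (d d' : partFamily gT -> partFamily gT -> {malg F[partFamily gT]}) :
  structure_constants d -> structure_constants d' -> forall rho sigma,
  d' rho sigma = d rho sigma.
Proof.
move=> [_ dP] [_ d'P] rho sigma; apply/eqP; rewrite -subr_eq0; apply/eqP.
apply: lincomb_p_eq0 => n n_gt0.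
by rewrite lincombB -dP // -d'P // subrr.
Qed.

(** A class function is a combination of orbit sums, and in degree [n] these are the P_x(n) with [x]
    in Gamma_n. *)
Lemma lincomb_p_onto n (f : classAlg F (wreath gT n)) :
  exists e, lincomb (@p_ F gT ^~ n) e = f.
Proof.
suff [e [_ fE]] : stably_spanned n (fun m => #|{: wreath gT n}|%:R^-1 *:
    \sum_(x : wreath gT n) f x *: linj_sum F x m).
  exists e; apply: val_inj; rewrite /= -fE [in RHS](classfun_orbsum f).
  rewrite classfunZ classfun_sum; congr (_ *: _); apply: eq_bigr => x _.
  by rewrite classfunZ linj_sum_full.
apply: stably_spannedZ; apply: stably_spanned_sum => x _.
by apply: stably_spannedZ; apply: linj_sum_spanned.
Qed.

Definition empty_family : partFamily gT :=
  [ffun=> IntPart (isT : sorted geq [::] && (0%N \notin [::]))].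

Lemma p_empty n : p_ F empty_family n = 1.
Proof.
have size0 : famsize empty_family = 0%N.
  by rewrite /famsize big1 // => c _; rewrite ffunE.
have t0 : has_family_type empty_family (1%g : wreath gT 0).
  by apply/has_family_typeP => r c; rewrite /ncyc big_ord0 /mult ffunE muln0.
have [_ [kappa k0 kE]] := p_linj_sum F t0.
have linj1 m : linj_sum F (1%g : wreath gT 0) m = 1.
  rewrite /linj_sum; under eq_bigr => phi _ do rewrite push1.
  rewrite sumr_const (_ : #|_| = #|{: linj gT 0 m}|) // card_linj ffactn0.
  by rewrite mulr1n.
have p00 : p_ F empty_family 0 = 1.
  rewrite /p_ size0 /= fact0 invr1 scale1r.
  rewrite part_vectorE (_ : creation_seq _ _ = vacuum F gT) ?component_inDegree //.
  rewrite -part_vectorE /part_vector big_compE size0.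
  elim: (index_enum _) => //= c s ->.
  by rewrite big_geq.
(* The constant is the same in all degrees, so it is determined in degree 0, where p_rho(0) is the
   unit. *)
have k1 : kappa = 1.
  have := kE 0%N; rewrite p00 linj1 => /(congr1 (fun f : groupAlg F _ => f 1%g)).
  by rewrite groupAlgZE /= !ffunE eqxx mulr1.
by apply: val_inj; rewrite /= kE linj1 k1 scale1r.
Qed.

End LinearCombinations.

(** * The stable algebra and its specializations *)

Section StableAlgebra.
Variables (F : numFieldType) (gT : finGroupType).
Variable d : partFamily gT -> partFamily gT -> {malg F[partFamily gT]}.
Hypothesis dP : structure_constants d.

(** The argument makes the type depend on [d], so that the free module can carry the multiplication
    defined by these constants. *)
Definition stableAlg of structure_constants d := {malg F[partFamily gT]}.
Local Notation A := (stableAlg dP).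
HB.instance Definition _ := GRing.Lmodule.on A.

Definition smul (x y : A) : A := lincomb (fun rho => lincomb (d rho) y) x.
Definition sone : A := << empty_family gT >>.
Definition specialize n : A -> classAlg F (wreath gT n) := lincomb (@p_ F gT ^~ n).

(** This reduces the axioms of the stable algebra involving the product to those of the class
    algebras in positive degree, where the structure constants describe the product. *)
Lemma specialize_inj (x y : A) :
  (forall n, (0 < n)%N -> specialize n x = specialize n y) -> x = y.
Proof.
move=> xy; apply/eqP; rewrite -subr_eq0; apply/eqP/lincomb_p_eq0 => n n_gt0.
by have := xy n n_gt0; rewrite /specialize lincombB => ->; rewrite subrr.
Qed.

Lemma specializeM n x y : (0 < n)%N ->
  specialize n (smul x y) = specialize n x * specialize n y.
Proof.
move=> n_gt0; rewrite /specialize /smul lincomb_lin mulr_suml.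
apply: eq_bigr => rho _; rewrite -scalerAl; congr (_ *: _) => /=.
rewrite lincomb_lin mulr_sumr; apply: eq_bigr => sigma _.
by rewrite -scalerAr; congr (_ *: _); rewrite /= dP.2.
Qed.

Lemma specialize1 n : specialize n sone = 1.
Proof. by rewrite /specialize lincombU p_empty. Qed.

Lemma specializeD n : {morph specialize n : x y / x + y}.
Proof. by move=> x y; apply: lincombD. Qed.

Lemma specializeZ n a : {morph specialize n : x / a *: x}.
Proof. by move=> x; apply: lincombZ. Qed.

Lemma smulA : associative smul.
Proof. by move=> x y z; apply: specialize_inj => n n0; rewrite !specializeM ?mulrA. Qed.

Lemma smul1x : left_id sone smul.
Proof. by move=> x; apply: specialize_inj => n n0; rewrite specializeM // specialize1 mul1r. Qed.

Lemma smulx1 : right_id sone smul.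
Proof. by move=> x; apply: specialize_inj => n n0; rewrite specializeM // specialize1 mulr1. Qed.

Lemma smulDl : left_distributive smul +%R.
Proof.
by move=> x y z; apply: specialize_inj => n n0; rewrite !(specializeD, specializeM) // mulrDl.
Qed.

Lemma smulDr : right_distributive smul +%R.
Proof.
by move=> x y z; apply: specialize_inj => n n0; rewrite !(specializeD, specializeM) // mulrDr.
Qed.

Lemma sone_neq0 : sone != 0.
Proof. by rewrite monalgU_eq0 oner_eq0. Qed.

HB.instance Definition _ := GRing.Zmodule_isNzRing.Build A
  smulA smul1x smulx1 smulDl smulDr sone_neq0.

Lemma smulZl a (x y : A) : a *: (x * y) = (a *: x) * y.
Proof.
by apply: specialize_inj => n n0; rewrite !(specializeZ, specializeM) // scalerAl.
Qed.

HB.instance Definition _ := GRing.Lmodule_isLalgebra.Build F A smulZl.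

Lemma smulZr a (x y : A) : a *: (x * y) = x * (a *: y).
Proof.
by apply: specialize_inj => n n0; rewrite !(specializeZ, specializeM) // scalerAr.
Qed.

HB.instance Definition _ := GRing.Lalgebra_isAlgebra.Build F A smulZr.

(** Writing the degree as a successor builds positivity into the type, so that the morphism
    structure can be declared without a side condition. *)
Definition specializeS n : A -> classAlg F (wreath gT n.+1) := specialize n.+1.

Lemma specializeS_linear n : linear (specializeS n).
Proof. by move=> a x y; rewrite /specializeS specializeD specializeZ. Qed.

Lemma specializeS_monoid n : monoid_morphism (specializeS n).
Proof. by split=> [|x y]; [apply: specialize1 | apply: specializeM]. Qed.

HB.instance Definition _ n := GRing.isLinear.Build F A
  (classAlg F (wreath gT n.+1)) _ (specializeS n) (specializeS_linear n).
HB.instance Definition _ n := GRing.isMonoidMorphism.Build A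
  (classAlg F (wreath gT n.+1)) (specializeS n) (specializeS_monoid n).

Definition stable_basis nu : A := << nu >>.

Lemma lincomb_stable_basis (x : A) : lincomb stable_basis x = x.
Proof. exact: lincomb_monomials. Qed.

Lemma stable_basisM rho sigma :
  stable_basis rho * stable_basis sigma = lincomb stable_basis (d rho sigma).
Proof. by rewrite lincomb_stable_basis [LHS]lincombU lincombU. Qed.

End StableAlgebra.

Theorem theorem5p4 (R : realType) (gT : finGroupType) :
  exists d : partFamily gT -> partFamily gT -> {malg R[i][partFamily gT]},
    [/\ structure_constants d,
        forall d' : partFamily gT -> partFamily gT ->
                      {malg R[i][partFamily gT]},
          structure_constants d' ->
          forall rho sigma : partFamily gT, d' rho sigma = d rho sigma
      & exists (A : algType R[i]) (p : partFamily gT -> A),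
          [/\ bijective (lincomb p),
              forall rho sigma : partFamily gT,
                p rho * p sigma = lincomb p (d rho sigma)
            & forall n : nat, (0 < n)%N ->
                exists Phi : {lrmorphism A -> classAlg R[i] (wreath gT n)},
                  (forall rho : partFamily gT, Phi (p rho) = p_ R[i] rho n) /\
                  (forall f : classAlg R[i] (wreath gT n),
                     exists a : A, Phi a = f)]].
Proof.
have [d dP] := @structure_constants_exist R[i] gT.
exists d; split=> //; first by move=> d'; apply: structure_constants_uniq.
exists (stableAlg dP), (@stable_basis R[i] gT d dP); split.
(* In the monomial basis, [lincomb] is the identity map. *)
- by exists id => x; apply: lincomb_stable_basis.
- exact: stable_basisM.
case=> // n _; exists (@specializeS R[i] gT d dP n); split=> [rho | f].
  exact: lincombU.
exact: lincomb_p_onto.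
Qed.
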